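(* Let $X$ be a locally convex space and let $(T(t))_{t\geqslant0}$ be an exponentially bounded $C_0$-semigroup on $X$. Consider the following statements, where each of (iii), (iv), (v) comes in two versions: one with ''for all'' and one with ''there exists'' as the first quantifier. (i) $(T(t))_{t\geqslant0}$ is super polynomially stable. (ii) $\exists\,\alpha>1\ \forall\, B\in\mathcal{B}_X,\, q\in\Gamma_X$: $\lim_{t\to\infty}q_B(t^{\alpha}T(t))=0$. (iii) For all, or, equivalently, for some $\alpha>1$: $\forall\, q\in\Gamma_X\ \exists\, p\in\Gamma_X$: $\lim_{t\to\infty}\sup_{p(x)\leqslant1}q(t^{\alpha}T(t)x)=0$. (iv) For all, or, equivalently, for some $\alpha>1$: $\forall\, x\in X$: $\lim_{t\to\infty}t^{\alpha}T(t)x=0$. (v) For all, or, equivalently, for some $\beta\geqslant1$: $\forall\, q\in\Gamma_X,\, x\in X$: $\int_0^\infty q(T(t)x)^{\beta}\,dt<\infty$. (vi) $\forall\, x\in X\ \exists\,\alpha>1$: $\lim_{t\to\infty}t^{\alpha}T(t)x=0$. (vii) $\forall\, B\in\mathcal{B}_X\ \exists\,\alpha>1\ \forall\, q\in\Gamma_X$: $\lim_{t\to\infty}q_B(t^{\alpha}T(t))=0$. If $X$ is barrelled, then (i)--(v) (including both versions of each of (iii), (iv) and (v)) are equivalent. If $X$ is Mackey complete, then (vi) and (vii) are equivalent. If $X$ is a Baire space, then all statements (i)--(vii) are equivalent.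
   Context: Locally convex spaces are assumed Hausdorff. For a locally convex space $X$, $\Gamma_X$ denotes a fundamental system of continuous seminorms determining the topology of $X$ (every element of $\Gamma_X$ is a continuous seminorm, and for each continuous seminorm $p$ on $X$ there are $q\in\Gamma_X$ and $C\geqslant0$ with $p\leqslant Cq$), $L(X)$ is the space of all continuous linear operators $X\to X$, and $\mathcal{B}_X$ is the collection of all bounded subsets of $X$. For $q\in\Gamma_X$, $B\in\mathcal{B}_X$ and $S\in L(X)$ put $q_B(S)=\sup_{x\in B}q(Sx)$. $X$ is barrelled if every absolutely convex, absorbing and closed set is a neighborhood of zero. A sequence $(x_n)_{n\in\mathbb{N}}$ in $X$ is Mackey Cauchy if there exist $B\in\mathcal{B}_X$ and scalars $b_{n,k}$ tending to zero as $n$ and $k$ both tend to infinity such that $x_n-x_k\in b_{n,k}B$ for all $n,k\in\mathbb{N}$; $X$ is Mackey complete if every Mackey Cauchy sequence in $X$ converges. $X$ is a Baire space if $X$ cannot be written as a countable union of nowhere dense sets. A $C_0$-semigroup on $X$ is a family $(T(t))_{t\geqslant0}\subseteq L(X)$ with $T(0)=\mathrm{id}_X$, $T(s+t)=T(s)T(t)$ for all $s,t\geqslant0$, and $\lim_{t\to t_0}T(t)x=T(t_0)x$ for all $t_0\geqslant0$, $x\in X$. It is exponentially bounded if $\forall q\in\Gamma_X\ \exists p\in\Gamma_X, M\geqslant1,\omega\in\mathbb{R}\ \forall t\geqslant0, x\in X$: $q(T(t)x)\leqslant Me^{\omega t}p(x)$. It is super polynomially stable if $\forall\alpha>1, B\in\mathcal{B}_X,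 q\in\Gamma_X$: $\lim_{t\to\infty}q_B(t^{\alpha}T(t))=0$. *)

(* Defs.v *)
From HB Require Import structures.
From mathcomp Require Import all_boot all_order all_algebra.
From mathcomp Require Import all_classical all_reals all_analysis.
From mathcomp Require Import complex.

Set Implicit Arguments.
Unset Strict Implicit.
Unset Printing Implicit Defensive.

Import Order.TTheory GRing.Theory Num.Theory.
Import numFieldNormedType.Exports.

Local Open Scope classical_set_scope.
Local Open Scope ring_scope.

(* A locally convex space is taken over the reals or over the complex numbers. *)
Inductive scalar_kind := real_scalars | complex_scalars.

Definition scalars (R : realType) (F : scalar_kind) : numFieldType :=
  match F with
  | real_scalars => R
  | complex_scalars => R[i]
  end.

Definition scalar_of_real (R : realType) (F : scalar_kind) : R -> scalars R F :=
  match F return R -> scalars R F with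
  | real_scalars => fun r => r
  | complex_scalars => fun r => real_complex R r
  end.

Section LocallyConvex.
Context (R : realType) (F : scalar_kind).
Local Notation K := (scalars R F).
Local Notation inK := (scalar_of_real F).
Context (X : tvsType K).
Implicit Types (A B U : set X) (G : set (X -> R)) (p q : X -> R).

(* Homogeneity is an identity in K because the library's norm of a scalar is
   itself an element of K; nonnegativity of p follows from these two axioms. *)
Definition seminorm p : Prop :=
  (forall x y, p (x + y) <= p x + p y) /\
  (forall (a : K) x, inK (p (a *: x)) = `|a| * inK (p x)).

Definition fundamental_system G : Prop :=
  (forall q, G q -> seminorm q /\ continuous q) /\
  (forall p, seminorm p -> continuous p ->
    exists2 q, G q & exists2 C : R, 0 <= C & forall x, p x <= C * q x).

Definition absorbs A B : Prop :=
  exists2 r : K, 0 < r & forall a : K, r <= `|a| -> B `<=` [set a *: y | y in A].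

Definition bounded_subset B : Prop :=
  forall U, nbhs (0 : X) U -> absorbs U B.

Definition absolutely_convex A : Prop :=
  forall x y (a b : K), A x -> A y -> `|a| + `|b| <= 1 -> A (a *: x + b *: y).

Definition absorbing A : Prop := forall x, absorbs A [set x].

Definition barrelled : Prop :=
  forall A, absolutely_convex A -> absorbing A -> closed A -> nbhs (0 : X) A.

Definition mackey_cauchy (x : nat -> X) : Prop :=
  exists B (b : nat -> nat -> K),
    [/\ bounded_subset B,
        b nk.1 nk.2 @[nk --> filter_prod \oo \oo] --> (0 : K) &
        forall n k, [set b n k *: y | y in B] (x n - x k)].

Definition mackey_complete : Prop :=
  forall x : nat -> X, mackey_cauchy x -> exists l : X, x @ \oo --> l.

Definition nowhere_dense A : Prop := interior (closure A) = set0.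

Definition baire_space : Prop :=
  ~ exists2 N : nat -> set X,
      (forall n, nowhere_dense (N n)) & \bigcup_n N n = [set: X].

(* Supremum in [0, +oo], so that the supremum over the empty set is 0. *)
Definition sup_on B (f : X -> R) : \bar R :=
  ereal_sup (0%E |` [set (f x)%:E | x in B]).

Definition op_seminorm q B (S : X -> X) : \bar R := sup_on B (q \o S).

Section Semigroup.
Context (T : R -> X -> X).

(* Only the values T t with t >= 0 are constrained or used. *)
Record C0_semigroup : Prop := {
  C0_linear : forall t, 0 <= t -> linear (T t) ;
  C0_continuous : forall t, 0 <= t -> continuous (T t) ;
  C0_zero : T 0 = id ;
  C0_add : forall s t, 0 <= s -> 0 <= t -> T (s + t) = T s \o T t ;
  C0_strong : forall x, {within `[0, +oo[, continuous (fun t => T t x)} }.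

Definition exponentially_bounded G : Prop :=
  forall q, G q -> exists2 p, G p & exists M omega : R,
    1 <= M /\ forall t x, 0 <= t -> q (T t x) <= M * expR (omega * t) * p x.

Definition weighted (alpha t : R) : X -> X :=
  fun x => inK (t `^ alpha) *: T t x.

Definition uniform_decay_on (alpha : R) B q : Prop :=
  op_seminorm q B (weighted alpha t) @[t --> +oo%R] --> 0%E.

Definition bounded_decay G (alpha : R) : Prop :=
  forall B q, bounded_subset B -> G q -> uniform_decay_on alpha B q.

Definition super_polynomially_stable G : Prop :=
  forall alpha : R, 1 < alpha -> bounded_decay G alpha.

Definition seminorm_decay G (alpha : R) : Prop :=
  forall q, G q -> exists2 p, G p &
    sup_on [set x | p x <= 1] (q \o weighted alpha t) @[t --> +oo%R] --> 0%E.

Definition pointwise_decay (alpha : R) (x : X) : Prop :=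
  weighted alpha t x @[t --> +oo%R] --> (0 : X).

Definition integrable_orbits G (beta : R) : Prop :=
  forall q x, G q ->
    (\int[lebesgue_measure]_(t in `[0%R, +oo[) (q (T t x) `^ beta)%:E < +oo)%E.

End Semigroup.
End LocallyConvex.

(* Main.v *)
Require Import Defs.
From HB Require Import structures.
From mathcomp Require Import all_boot all_order all_algebra.
From mathcomp Require Import all_classical all_reals all_analysis.
From mathcomp Require Import complex measurable_realfun ring lra.

Set Implicit Arguments.
Unset Strict Implicit.
Unset Printing Implicit Defensive.

Import Order.TTheory GRing.Theory Num.Theory.
Import numFieldNormedType.Exports.

Local Open Scope classical_set_scope.
Local Open Scope ring_scope.

(* By local convexity (Minkowski gauges) G generates the topology of X, so that
   (i), (ii), (iii) all give (iv), and (iii) gives (i) as continuous seminorms are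
   bounded on bounded sets. Pointwise decay of order a > 1 makes orbits integrable
   to every power b >= 1. The core is a Datko-type argument: integrability yields,
   by the exponential bound, a bound on sum_n q(T(n)x)^b for each x, so that
   {x | sum_n q(T(n)x)^b <= 1} is a barrel. If it is a neighbourhood of zero, then
   q(T(n)x) <= C p(x); writing T(n) = T(n - m) T(m) and summing over m <= n gives
   q(T(t)x) <= C t^(-1/b) p(x), and T(t) = T(t/2) T(t/2) doubles the exponent, so
   the decay is of every polynomial order, which is (iii).
   Under (vi) the closed absolutely convex sets {x | t^r q(T(t)x) <= k for all t}
   cover X: with r = 1 and q fixed when X is Baire; with r = 1 + 1/(n+1) and a
   seminorm q_n violating (vii) for each n when X is Mackey complete, where a
   gliding hump shows that one of countably many such sets absorbs the given
   bounded set. *)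

(** * Scalars and seminorms *)

Section Scalars.
Context (R : realType) (F : scalar_kind).
Local Notation K := (scalars R F).
Local Notation inK := (@scalar_of_real R F).

Lemma scalar_of_real_zmod : zmod_morphism inK.
Proof. by case: F => x y //=; rewrite rmorphB. Qed.

Lemma scalar_of_real_monoid : monoid_morphism inK.
Proof. by case: F; split=> //= x y; rewrite rmorphM. Qed.

HB.instance Definition _ :=
  GRing.isZmodMorphism.Build R K inK scalar_of_real_zmod.
HB.instance Definition _ :=
  GRing.isMonoidMorphism.Build R K inK scalar_of_real_monoid.

Lemma ler_scalar x y : (inK x <= inK y) = (x <= y).
Proof. by case: F => //=; rewrite lecR. Qed.

Lemma ltr_scalar x y : (inK x < inK y) = (x < y).
Proof. by case: F => //=; rewrite ltcR. Qed.

(** The norm of K takes values in K; over the complex numbers it has zero imaginary part, so the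
    real part keeps all of it. *)
Definition scalar_abs : K -> R :=
  match F return scalars R F -> R with
  | real_scalars => fun a => `|a|
  | complex_scalars => fun a => complex.Re `|a|
  end.

Lemma scalar_absE a : inK (scalar_abs a) = `|a|.
Proof. by rewrite /scalar_abs; case: F a => //= a; rewrite normc_def. Qed.

Lemma scalar_inj : injective inK.
Proof. exact: fmorph_inj. Qed.

Lemma scalar_abs_ge0 a : 0 <= scalar_abs a.
Proof. by rewrite -ler_scalar scalar_absE rmorph0. Qed.

Lemma scalar_abs_of_real r : scalar_abs (inK r) = `|r|.
Proof.
apply: scalar_inj; rewrite scalar_absE.
have [r0|r0] := leP 0 r.
  by rewrite [`|r|]ger0_norm// ger0_norm// -(rmorph0 inK) ler_scalar.
rewrite [`|r|]ltr0_norm// rmorphN ltr0_norm//.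
by rewrite -(rmorph0 inK) ltr_scalar.
Qed.

Lemma scalar_gt0 (e : K) : 0 < e -> exists2 r : R, 0 < r & e = inK r.
Proof.
move=> e0; have eE : e = inK (scalar_abs e) by rewrite scalar_absE gtr0_norm.
by exists (scalar_abs e) => //; rewrite -ltr_scalar -eE rmorph0.
Qed.

Lemma scalar_abs_eq0 (a : K) : scalar_abs a = 0 -> a = 0.
Proof. by move=> a0; apply/normr0_eq0; rewrite -scalar_absE a0 rmorph0. Qed.

Lemma scalar_absM (a b : K) : scalar_abs (a * b) = scalar_abs a * scalar_abs b.
Proof. by apply: scalar_inj; rewrite rmorphM/= !scalar_absE normrM. Qed.

Lemma scalar_absV (a : K) : scalar_abs a^-1 = (scalar_abs a)^-1.
Proof. by apply: scalar_inj; rewrite fmorphV/= !scalar_absE normfV. Qed.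

(** Splits a coefficient into a real weight and a scalar of the unit disk, so that real convexity
    and balancedness together yield absolute convexity. *)
Lemma scalar_factor (a : K) (s : R) : scalar_abs a <= s ->
  exists2 u : K, scalar_abs u <= 1 & a = inK s * u.
Proof.
move=> ales; have s0 := le_trans (scalar_abs_ge0 a) ales.
have [s00|sn0] := eqVneq s 0.
  exists 0; first by rewrite -(rmorph0 inK) scalar_abs_of_real normr0.
  rewrite mulr0; apply: scalar_abs_eq0; apply/le_anti.
  by rewrite scalar_abs_ge0 -s00 ales.
have s_gt0 : 0 < s by rewrite lt_def sn0.
exists (inK s^-1 * a); last by rewrite mulrA -rmorphM divff// rmorph1 mul1r.
by rewrite scalar_absM scalar_abs_of_real gtr0_norm ?invr_gt0// ler_pdivrMl// mulr1.
Qed.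

End Scalars.

Section Seminorms.
Context (R : realType) (F : scalar_kind).
Local Notation K := (scalars R F).
Local Notation inK := (@scalar_of_real R F).
Context (X : tvsType K).
Implicit Types (A B U : set X) (G : set (X -> R)) (p q : X -> R).

Section Properties.
Variable p : X -> R.
Hypothesis sp : seminorm p.

Lemma seminormD x y : p (x + y) <= p x + p y.
Proof. exact: sp.1. Qed.

Lemma seminormZ a x : p (a *: x) = scalar_abs a * p x.
Proof.
by apply: (@scalar_inj _ F); rewrite sp.2 rmorphM/= scalar_absE.
Qed.

Lemma seminormZr r x : p (inK r *: x) = `|r| * p x.
Proof. by rewrite seminormZ scalar_abs_of_real. Qed.

Lemma seminorm0 : p 0 = 0.
Proof. by rewrite -(scale0r 0) -(rmorph0 inK) seminormZr normr0 mul0r. Qed.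

Lemma seminormN x : p (- x) = p x.
Proof.
by rewrite -scaleN1r -(rmorph1 inK) -rmorphN seminormZr normrN1 mul1r.
Qed.

Lemma seminorm_ge0 x : 0 <= p x.
Proof.
have := seminormD x (- x); rewrite subrr seminorm0 seminormN; lra.
Qed.

Lemma seminorm_dist x y : `|p x - p y| <= p (x - y).
Proof.
have := seminormD (x - y) y; have := seminormD (y - x) x.
rewrite !subrK -opprB seminormN ler_norml; lra.
Qed.

End Properties.

Lemma scale_contr (a : K) : continuous (fun x : X => a *: x).
Proof.
move=> x; apply: (@continuous_comp X (K^o * X)%type X (fun x => (a, x))
  (fun z => z.1 *: z.2)); last exact: scale_continuous.
by apply: (@cvg_pair _ _ _ _ (nbhs (a : K^o))); [exact: cvg_cst|exact: cvg_id].
Qed.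

Lemma add_contr (y : X) : continuous (fun x : X => y + x).
Proof.
move=> x; apply: (@continuous_comp X (X * X)%type X (fun x => (y, x))
  (fun z => z.1 + z.2)); last exact: add_continuous.
by apply: (@cvg_pair _ _ _ _ (nbhs y)); [exact: cvg_cst|exact: cvg_id].
Qed.

Lemma nbhs_scale (a : K) U : nbhs (0 : X) U -> nbhs (0 : X) [set x | U (a *: x)].
Proof. by move=> U0; apply: (@scale_contr a 0); rewrite /= scaler0. Qed.

Lemma nbhs_translate (y : X) U : nbhs y U -> nbhs (0 : X) [set x | U (y + x)].
Proof. by move=> U0; apply: (@add_contr y 0); rewrite /= addr0. Qed.

Lemma nbhs_translate0 (y : X) U :
  nbhs (0 : X) U -> nbhs y [set x | U (x - y)].
Proof.
move=> U0; have := @add_contr (- y) y U; rewrite addNr => /(_ U0) yU.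
rewrite (_ : [set x | _] = [set x | U (- y + x)])//.
by apply/seteqP; split=> x /=; rewrite addrC.
Qed.

Lemma seminorm_continuous p : seminorm p -> nbhs (0 : X) [set x | p x <= 1] ->
  continuous p.
Proof.
move=> sp p1 x; apply/cvgrPdist_le => e e0.
have := nbhs_translate0 x (nbhs_scale (inK e^-1) p1); apply: filterS => y /=.
rewrite seminormZr// gtr0_norm ?invr_gt0// ler_pdivrMl// mulr1.
by apply: le_trans; rewrite distrC; exact: seminorm_dist.
Qed.

Lemma scale_nbhs0 (U : set X) : nbhs (0 : X) U ->
  exists2 r : R, 0 < r & exists2 V, nbhs (0 : X) V &
    forall a x, scalar_abs a < r -> V x -> U (a *: x).
Proof.
move=> U0.
have := @scale_continuous K X (0, 0) U; rewrite /= scale0r => /(_ U0).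
case=> -[/= A V] [[e /= /(@scalar_gt0 R F)[r r0 ->] Ar] V0] AVU.
exists r => //; exists V => // a x ar Vx.
apply: (AVU (a, x)); split => //; apply: Ar => /=.
by rewrite sub0r normrN -scalar_absE ltr_scalar.
Qed.

Lemma nbhs0_convex (U : set X) : nbhs (0 : X) U ->
  exists V : set X, [/\ nbhs 0 V, V `<=` U &
    forall (r : R) x y, 0 <= r <= 1 -> V x -> V y ->
      V (inK r *: x + inK (1 - r) *: y)].
Proof.
have [Bs cB [oB /(_ 0 U) bB]] := @locally_convex K X.
move=> /bB[V [BV V0] VU]; exists V; split=> //.
  by apply: open_nbhs_nbhs; split => //; exact: oB.
move=> r x y /andP[r0 r1] Vx Vy.
have k0 : 0 <= inK r by rewrite -(rmorph0 inK) ler_scalar.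
have k1 : inK r <= 1 by rewrite -(rmorph1 inK) ler_scalar.
have := cB V (mem_set BV) x y (Itv01 k0 k1) (mem_set Vx) (mem_set Vy).
rewrite inE; suff -> : inK (1 - r) = 1 - inK r by [].
by rewrite rmorphB rmorph1.
Qed.

Lemma abs_convexE A : absolutely_convex A <->
  forall x y (a b : K), A x -> A y -> scalar_abs a + scalar_abs b <= 1 ->
    A (a *: x + b *: y).
Proof.
split=> cA x y a b Ax Ay ab; apply: cA => //.
  by rewrite -!scalar_absE -rmorphD -(rmorph1 inK) ler_scalar.
by move: ab; rewrite -!scalar_absE -rmorphD -(rmorph1 inK) ler_scalar.
Qed.

Lemma abs_convexZ A x (a : K) : absolutely_convex A -> A x ->
  scalar_abs a <= 1 -> A (a *: x).
Proof.
move=> /abs_convexE cA Ax a1; have := cA x x a 0 Ax Ax.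
by rewrite scale0r addr0 -(rmorph0 inK) scalar_abs_of_real normr0 addr0; apply.
Qed.

Lemma abs_convex0 A x : absolutely_convex A -> A x -> A 0.
Proof.
move=> cA Ax; rewrite -(scale0r x); apply: abs_convexZ => //.
by rewrite -(rmorph0 inK) scalar_abs_of_real normr0.
Qed.

(** Local convexity supplies only a convex [V]. Its balanced core, the points whose multiples by the
    unit disk stay in [V], is still convex and, by joint continuity of scaling at zero, still a
    neighbourhood. *)
Lemma nbhs0_abs_convex U : nbhs (0 : X) U ->
  exists W : set X, [/\ nbhs 0 W, W `<=` U & absolutely_convex W].
Proof.
move=> /nbhs0_convex[V [V0 VU cV]].
have a1 : scalar_abs (1 : K) = 1 by rewrite -(rmorph1 inK) scalar_abs_of_real normr1.
exists [set x | forall a, scalar_abs a <= 1 -> V (a *: x)]; split.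
- have [r r0 [V' V'0 V'V]] := scale_nbhs0 V0.
  apply: filterS (nbhs_scale (inK (2 / r)) V'0) => x /= V'x a a1'.
  have -> : a *: x = (a * inK (r / 2)) *: (inK (2 / r) *: x).
    rewrite scalerA -mulrA -rmorphM mulf_div mulrC (mulrC 2) divff ?rmorph1 ?mul1r//.
    by rewrite mulf_neq0// gt_eqF.
  apply: V'V => //; rewrite scalar_absM scalar_abs_of_real gtr0_norm ?divr_gt0//.
  by apply: (@le_lt_trans _ _ (1 * (r / 2))); [rewrite ler_wpM2r//; lra|lra].
- by move=> x /(_ 1); rewrite a1 scale1r => /(_ (lexx _)) /VU.
- apply/abs_convexE => x y a b /= Wx Wy ab c c1.
  rewrite scalerDr !scalerA.
  (* As |c a| <= |a| and |c b| <= 1 - |a|, the two terms are disk multiples of [x] and [y] with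
     convex weights |a| and 1 - |a|. *)
  have [ca cb] : scalar_abs (c * a) <= scalar_abs a /\
      scalar_abs (c * b) <= scalar_abs b.
    by rewrite !scalar_absM; split; rewrite ler_piMl// scalar_abs_ge0.
  have [u u1 ->] := scalar_factor ca.
  have [|v v1 ->] := @scalar_factor R F (c * b) (1 - scalar_abs a); first lra.
  rewrite -!scalerA; apply: cV; [|exact: Wx|exact: Wy].
  by rewrite scalar_abs_ge0/=; have := scalar_abs_ge0 b; lra.
Qed.

(** [p] is the Minkowski gauge of an absolutely convex neighbourhood [W] contained in [U]. *)
Lemma gauge_seminorm U : nbhs (0 : X) U ->
  exists p, [/\ seminorm p, continuous p & forall x, p x < 1 -> U x].
Proof.
move=> /nbhs0_abs_convex[W [W0 WU cW]].
pose S x := [set r : R | 0 < r /\ W (inK r^-1 *: x)].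
have mono r s x : 0 < r -> r <= s -> W (inK r^-1 *: x) -> W (inK s^-1 *: x).
  move=> r0 rs Wr; have s0 := lt_le_trans r0 rs.
  have -> : inK s^-1 *: x = inK (r / s) *: (inK r^-1 *: x).
    by rewrite scalerA -rmorphM/= mulrAC divff ?gt_eqF// mul1r.
  apply: abs_convexZ => //; rewrite scalar_abs_of_real gtr0_norm ?divr_gt0//.
  by rewrite ler_pdivrMr// mul1r.
(* Continuity of scaling at (0, x) shows that [W] absorbs [x]. *)
have Sne x : S x !=set0.
  have /= := @scale_continuous K X (0, x) W; rewrite /= scale0r => /(_ W0).
  case=> -[/= A V] [[e /= /(@scalar_gt0 R F)[r r0 ->] Ar] Vx] AVW.
  exists (2 / r); split; first by rewrite divr_gt0.
  apply: (AVW (inK (2 / r)^-1, x)); split => //=; last exact: nbhs_singleton.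
  apply: Ar => /=; rewrite sub0r normrN -scalar_absE ltr_scalar scalar_abs_of_real.
  by rewrite invf_div gtr0_norm ?divr_gt0//; lra.
have Slb x : has_lbound (S x) by exists 0 => r [/ltW].
pose p x := inf (S x).
have p_le r x : 0 < r -> W (inK r^-1 *: x) -> p x <= r.
  by move=> r0 Wr; apply: ge_inf => //; split.
have p_lt x e : p x < e -> W (inK e^-1 *: x) /\ 0 < e.
  move=> pe; have infS : has_inf (S x) := conj (Sne x) (Slb x).
  have [|r [r0 Wr] re] := @inf_adherent R (S x) (e - p x) _ infS.
    by rewrite subr_gt0.
  have {}re : r <= e by move: re; rewrite addrC subrK => /ltW.
  by split; [exact: mono Wr|exact: lt_le_trans re].
(* One inequality suffices: the reverse one is the same statement for [a^-1] at [a *: x]. *)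
have pZ a x : a != 0 -> p (a *: x) <= scalar_abs a * p x.
  move=> a0; have aa : 0 < scalar_abs a.
    rewrite lt_def scalar_abs_ge0 andbT.
    by apply: contra a0 => /eqP/scalar_abs_eq0 ->.
  apply/ler_addgt0Pr => e e0.
  have [|Wr r0] := p_lt x (p x + e / scalar_abs a); first by rewrite ltrDl divr_gt0.
  have -> : scalar_abs a * p x + e = scalar_abs a * (p x + e / scalar_abs a).
    by rewrite mulrDr mulrCA divff ?gt_eqF// mulr1.
  apply: p_le; first exact: mulr_gt0.
  set r := p x + _ in r0 Wr *.
  have -> : inK (scalar_abs a * r)^-1 *: (a *: x) =
      (inK (scalar_abs a)^-1 * a) *: (inK r^-1 *: x).
    by rewrite !scalerA invfM rmorphM/= mulrAC.
  apply: abs_convexZ => //.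
  by rewrite scalar_absM scalar_abs_of_real gtr0_norm ?invr_gt0// mulVf ?gt_eqF.
have p00 : p 0 = 0.
  apply/le_anti/andP; split.
    apply/ler_addgt0Pr => e e0; rewrite add0r; apply: p_le => //.
    by rewrite scaler0; exact: nbhs_singleton.
  by apply: lb_le_inf => // r [/ltW].
have sp : seminorm p.
  split=> [x y|a x].
    apply/ler_addgt0Pr => e e0.
    have [|Wx x0] := p_lt x (p x + e / 2); first by rewrite ltrDl divr_gt0.
    have [|Wy y0] := p_lt y (p y + e / 2); first by rewrite ltrDl divr_gt0.
    have -> : p x + p y + e = (p x + e / 2) + (p y + e / 2) by lra.
    set r := p x + _ in x0 Wx *; set s := p y + _ in y0 Wy *.
    have rs0 : 0 < r + s by exact: addr_gt0.
    apply: p_le => //; rewrite scalerDr.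
    (* (x + y) / (r + s) is the convex combination of x / r and y / s with weights r / (r + s) and s
       / (r + s). *)
    have -> : inK (r + s)^-1 *: x = inK (r / (r + s)) *: (inK r^-1 *: x).
      by rewrite scalerA -rmorphM/= mulrAC divff ?gt_eqF// mul1r.
    have -> : inK (r + s)^-1 *: y = inK (s / (r + s)) *: (inK s^-1 *: y).
      by rewrite scalerA -rmorphM/= mulrAC divff ?gt_eqF// mul1r.
    move/abs_convexE : cW; apply => //.
    by rewrite !scalar_abs_of_real !gtr0_norm ?divr_gt0// -mulrDl divff ?gt_eqF.
  rewrite -scalar_absE -rmorphM; congr inK.
  have [->|a0] := eqVneq a 0.
    by rewrite scale0r p00 -(rmorph0 inK) scalar_abs_of_real normr0 mul0r.
  apply/le_anti; rewrite pZ//=.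
  have aa : 0 < scalar_abs a.
    rewrite lt_def scalar_abs_ge0 andbT.
    by apply: contra a0 => /eqP/scalar_abs_eq0 ->.
  rewrite -ler_pdivlMl// -scalar_absV.
  by rewrite -[x in p x <= _](scalerK a0) pZ ?invr_eq0.
exists p; split => //.
  apply: seminorm_continuous => //; apply: filterS W0 => x Wx /=.
  by apply: p_le => //; rewrite invr1 rmorph1 scale1r.
by move=> x /p_lt[]; rewrite invr1 rmorph1 scale1r => /WU.
Qed.

End Seminorms.

(** * Barrels and coverings by closed disks *)

Section Topology.
Context (R : realType) (F : scalar_kind).
Local Notation K := (scalars R F).
Local Notation inK := (@scalar_of_real R F).
Context (X : tvsType K).
Implicit Types (A B U : set X) (p q : X -> R).

(* Rescale x to p-norm at most d, approximately since p x = 0 is allowed. *)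
Lemma homogeneous_dominated p (f : X -> R) (c d : R) : 0 < d -> 0 <= c ->
  seminorm p -> (forall r x, 0 <= r -> f (inK r *: x) = r * f x) ->
  (forall x, p x <= d -> f x <= c) -> forall x, f x <= c / d * p x.
Proof.
move=> d0 c0 sp fZ fc x; apply/ler_addgt0Pr => e e0.
(* The scale [s] used below divides by [c]; for c = 0 any positive rescaling of [x] into the ball
   gives [f x <= 0]. *)
have [c00|cn0] := eqVneq c 0.
  rewrite c00 !mul0r add0r.
  have px : 0 < p x + 1 by have := seminorm_ge0 sp x; lra.
  have dp : 0 < d / (p x + 1) by rewrite divr_gt0.
  have := fc (inK (d / (p x + 1)) *: x).
  rewrite seminormZr// (fZ _ _ (ltW dp)) gtr0_norm// c00 pmulr_rle0// => fx0.
  apply: le_trans (fx0 _) (ltW e0).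
  by rewrite mulrAC ler_pdivrMr// ler_pM2l//; lra.
have {cn0}c0 : 0 < c by rewrite lt_def cn0.
(* Chosen so that x scaled by d / s has p-norm at most [d], while c / (d / s) is exactly the claimed
   bound plus [e]. *)
set s := p x + e * d / c.
have ed0 : 0 < e * d / c by rewrite !(mulr_gt0,invr_gt0).
have s0 : 0 < s by rewrite ltr_wpDl ?seminorm_ge0.
have ds0 : 0 < d / s by rewrite divr_gt0.
have := fc (inK (d / s) *: x).
rewrite seminormZr// (fZ _ _ (ltW ds0)) gtr0_norm// => h.
have -> : c / d * p x + e = c / (d / s).
  by rewrite invf_div /s; field; rewrite !gt_eqF.
rewrite ler_pdivlMr// mulrC; apply: h.
by rewrite mulrAC ler_pdivrMr// ler_pM2l// /s lerDl ltW.
Qed.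

(** If x and x + 2z lie in [A], so does half their difference, which is z. *)
Lemma abs_convex_interior A : absolutely_convex A -> interior A !=set0 ->
  nbhs (0 : X) A.
Proof.
move=> cA [x Ax].
have Ax' : A x := nbhs_singleton Ax.
have := nbhs_scale (inK 2) (nbhs_translate Ax); apply: filterS => z /= Az.
have -> : z = inK 2^-1 *: (x + inK 2 *: z) + inK (- 2^-1) *: x.
  rewrite scalerDr scalerA -rmorphM mulVf// rmorph1 scale1r rmorphN scaleNr.
  by rewrite addrAC subrr add0r.
move/abs_convexE : cA; apply => //.
by rewrite !scalar_abs_of_real normrN gtr0_norm ?invr_gt0//; lra.
Qed.

Lemma baire_cover (C : nat -> set X) : baire_space X ->
  (forall n, closed (C n)) -> (forall n, absolutely_convex (C n)) ->
  (forall x, exists n, C n x) -> exists n, nbhs (0 : X) (C n).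
Proof.
move=> bX clC acC covC; apply: contrapT => nC; apply: bX; exists C.
  move=> n; rewrite /nowhere_dense -(closure_id (C n)).1//.
  apply/eqP; apply: contrapT => /negP/set0P ne.
  by apply: nC; exists n; exact: abs_convex_interior.
by apply/seteqP; split=> // x _; have [n Cx] := covC x; exists n.
Qed.

Lemma absorbing_scale A x : absorbing A ->
  exists2 r : R, 0 < r & forall s, r <= s -> A (inK s^-1 *: x).
Proof.
move=> /(_ x)[e /(@scalar_gt0 R F)[r r0 ->] h]; exists r => // s rs.
have s0 := lt_le_trans r0 rs.
have [|y Ay yx] := h (inK s) _ x erefl.
  by rewrite -scalar_absE ler_scalar scalar_abs_of_real gtr0_norm.
by rewrite -yx scalerA -rmorphM mulVf ?gt_eqF// rmorph1 scale1r.
Qed.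

(** [A] is stable under scalars of modulus at most 1, so one positive multiple of [x] in [A] settles
    all large scalars. *)
Lemma absorbingP A : absolutely_convex A ->
  (forall x, exists2 r : R, 0 < r & A (inK r *: x)) -> absorbing A.
Proof.
move=> cA h x; have [r r0 Ax] := h x.
exists (inK r^-1); first by rewrite -(rmorph0 inK) ltr_scalar invr_gt0.
move=> a; rewrite -scalar_absE ler_scalar => ra _ ->.
have aa : 0 < scalar_abs a by apply: lt_le_trans ra; rewrite invr_gt0.
have a0 : a != 0.
  apply: contraTneq aa => ->.
  by rewrite -(rmorph0 inK) scalar_abs_of_real normr0 ltxx.
exists (a^-1 *: x); last by rewrite scalerA divff// scale1r.
have -> : a^-1 *: x = (a^-1 * inK r^-1) *: (inK r *: x).
  by rewrite scalerA -mulrA -rmorphM mulVf ?gt_eqF// rmorph1 mulr1.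
apply: abs_convexZ => //; rewrite scalar_absM scalar_absV scalar_abs_of_real.
by rewrite gtr0_norm ?invr_gt0// ler_pdivrMl// mulr1.
Qed.

Lemma closed_scale A (a : K) : closed A -> closed [set x : X | A (a *: x)].
Proof. by move=> clA; apply: (continuous_closedP _).1 clA; exact: scale_contr. Qed.

Lemma abs_convex_scale A (a : K) :
  absolutely_convex A -> absolutely_convex [set x : X | A (a *: x)].
Proof.
move=> cA x y b c /= Ax Ay bc.
by rewrite scalerDr !scalerA ![a * _]mulrC -!scalerA; exact: cA.
Qed.

(** The integer multiples of a barrel form a closed cover of the space, and a multiple that is a
    neighbourhood of zero can be scaled back. *)
Lemma baire_barrelled : baire_space X -> barrelled X.
Proof.
move=> bX A cA aA clA.
have [n|n|x|n Cn] := @baire_cover (fun n => [set x | A (inK n.+1%:R^-1 *: x)]) bX.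
- exact: closed_scale.
- exact: abs_convex_scale.
- have [r r0 Ar] := absorbing_scale x aA.
  have [m rm] : exists m : nat, r <= m.+1%:R.
    exists (Num.bound r); rewrite (le_trans (ltW (archi_boundP (ltW r0))))//.
    by rewrite ler_nat.
  by exists m => /=; exact: Ar.
have := nbhs_scale (inK n.+1%:R) Cn; apply: filterS => x /=.
by rewrite scalerA -rmorphM mulVf// rmorph1 scale1r.
Qed.

Section FundamentalSystem.
Variable G : set (X -> R).
Hypothesis hG : fundamental_system G.

Lemma fund_seminorm q : G q -> seminorm q.
Proof. by move=> /hG.1[]. Qed.

Lemma fund_continuous q : G q -> continuous q.
Proof. by move=> /hG.1[]. Qed.

Lemma nbhs_seminorm_ball q d : G q -> 0 < d -> nbhs (0 : X) [set x | q x <= d].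
Proof.
move=> Gq d0; have := @fund_continuous q Gq 0.
rewrite /continuous_at (seminorm0 (fund_seminorm Gq)) => /cvgr0Pnorm_lt /(_ _ d0).
by apply: filterS => x /= /ltW; apply: le_trans; exact: ler_norm.
Qed.

(** A gauge for [U] is dominated by a multiple of a single member of [G], so the balls of [G] form a
    base at zero. *)
Lemma nbhs0_fundP U : nbhs (0 : X) U ->
  exists2 q, G q & exists2 d : R, 0 < d & forall x, q x <= d -> U x.
Proof.
move=> /gauge_seminorm[p [sp cp pU]].
have [q Gq [C C0 pC]] := hG.2 p sp cp; exists q => //.
(* The [+ 1] covers [C = 0]; the factor 2 bounds [p x] by 1/2, strictly below 1. *)
exists (2 * (C + 1))^-1; first by rewrite invr_gt0; lra.
move=> x qx; apply: pU; apply: (le_lt_trans (pC x)).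
apply: (@le_lt_trans _ _ ((C + 1) * (2 * (C + 1))^-1)).
  by apply: ler_pM => //; [exact/seminorm_ge0/fund_seminorm|lra].
by rewrite invfM mulrCA divff ?mulr1 ?invf_lt1; lra.
Qed.

Lemma cvg_fund T (Fl : set_system T) {FF : Filter Fl} (f : T -> X) :
  (f @ Fl --> (0 : X)) <-> (forall q, G q -> q (f t) @[t --> Fl] --> (0 : R)).
Proof.
split=> [f0 q Gq|h U /= /nbhs0_fundP[q Gq [d d0 qU]]].
  rewrite -(seminorm0 (fund_seminorm Gq)).
  by apply: continuous_cvg => //; exact: fund_continuous.
have /cvgr0Pnorm_lt/(_ _ d0) := h q Gq; apply: filterS => t /ltW qd.
by apply: qU; apply: le_trans qd; exact: ler_norm.
Qed.

Lemma bounded_fundP B : bounded_subset B <->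
  (forall q, G q -> exists2 M : R, 0 <= M & forall x, B x -> q x <= M).
Proof.
split=> [bB q Gq|h U /nbhs0_fundP[q Gq [d d0 qU]]].
  have [e /(@scalar_gt0 R F)[r r0 ->] h] := bB _ (nbhs_seminorm_ball Gq ltr01).
  exists r => [|x Bx]; first exact: ltW.
  have [|y /= qy <-] := h (inK r) _ x Bx.
    by rewrite -scalar_absE ler_scalar scalar_abs_of_real gtr0_norm.
  rewrite seminormZr; last exact: fund_seminorm.
  by rewrite gtr0_norm// ler_piMr// ltW.
have [M M0 qM] := h q Gq.
exists (inK ((M + 1) / d)).
  by rewrite -(rmorph0 inK) ltr_scalar divr_gt0//; lra.
move=> a; rewrite -scalar_absE ler_scalar => Ma x Bx.
have aa : 0 < scalar_abs a by apply: lt_le_trans Ma; rewrite divr_gt0//; lra.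
have a0 : a != 0.
  apply: contraTneq aa => ->.
  by rewrite -(rmorph0 inK) scalar_abs_of_real normr0 ltxx.
exists (a^-1 *: x); last by rewrite scalerA divff// scale1r.
apply: qU; rewrite seminormZ; last exact: fund_seminorm.
rewrite scalar_absV ler_pdivrMl//.
by move: Ma; rewrite ler_pdivrMr//; have := qM x Bx; lra.
Qed.

End FundamentalSystem.
End Topology.

(** * Gliding hump in Mackey complete spaces *)

Section MackeyCover.
Context (R : realType) (F : scalar_kind).
Local Notation K := (scalars R F).
Local Notation inK := (@scalar_of_real R F).
Context (X : tvsType K).
Variable G : set (X -> R).
Hypothesis hG : fundamental_system G.
Implicit Types (A B U : set X) (p q : X -> R).

(* Replaces the closed absolutely convex hull of B (it may be larger): it
   inherits boundedness from B directly. *)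
Definition seminorm_hull B : set X :=
  [set x | forall q M, G q -> (forall b, B b -> q b <= M) -> q x <= M].

Lemma sub_seminorm_hull B : B `<=` seminorm_hull B.
Proof. by move=> x Bx q M _; apply. Qed.

Lemma seminorm_hull_abs_convex B : B !=set0 -> absolutely_convex (seminorm_hull B).
Proof.
move=> [b0 Bb0]; apply/abs_convexE => x y a b Dx Dy ab q M Gq qM.
have sq := fund_seminorm hG Gq.
have M0 : 0 <= M by apply: le_trans (qM _ Bb0); exact: seminorm_ge0.
apply: (le_trans (seminormD sq _ _)); rewrite !seminormZ//.
apply: (@le_trans _ _ (scalar_abs a * M + scalar_abs b * M)).
  by apply: lerD; apply: ler_wpM2l => //; [exact: scalar_abs_ge0|exact: Dx|
    exact: scalar_abs_ge0|exact: Dy].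
by rewrite -mulrDl ler_piMl.
Qed.

Lemma seminorm_hull_bounded B : bounded_subset B -> bounded_subset (seminorm_hull B).
Proof.
move=> /(bounded_fundP hG) bB; apply/(bounded_fundP hG) => q Gq.
by have [M M0 qM] := bB q Gq; exists M => // x; apply.
Qed.

Lemma closed_seminorm_le q M : G q -> closed [set x | q x <= M].
Proof.
move=> Gq; have /continuous_closedP cq := fund_continuous hG Gq.
exact: cq (@closed_le R M).
Qed.

Lemma seminorm_hull_closed B : closed (seminorm_hull B).
Proof.
move=> x clx q M Gq qM; apply: (closed_seminorm_le Gq) => U /clx[y [Dy Uy]].
by exists y; split => //; exact: Dy.
Qed.

(* One step of the gliding hump: as C does not absorb B, moving y by a small
   multiple of B leaves C, and the complement of C is open. *)
Lemma leave_closed_set B (C : set X) : bounded_subset B -> closed C ->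
  absolutely_convex C ->
  (forall r : R, 0 < r -> exists2 b, B b & ~ C (inK r *: b)) ->
  forall (y : X) (d : R), 0 < d -> exists (y' : X) (d' : R),
    [/\ 0 < d', d' <= d / 2,
      exists2 v, seminorm_hull B v & y' = y + inK (d / 2) *: v &
      forall v, seminorm_hull B v -> ~ C (y' + inK d' *: v)].
Proof.
move=> bB clC acC nC y d d0.
(* The point (d / 4) b is half the difference of y + (d / 2) b and y, so these two cannot both lie
   in [C]. *)
have [b Bb Cb] : exists2 b, B b & ~ C (inK (d / 4) *: b) by apply: nC; lra.
have D0 : seminorm_hull B 0.
  move=> q M Gq qM; rewrite (seminorm0 (fund_seminorm hG Gq)).
  by apply: le_trans (qM _ Bb); exact: seminorm_ge0 (fund_seminorm hG Gq) _.
have [y' nCy' yy'] : exists2 y', ~ C y' &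
    exists2 v, seminorm_hull B v & y' = y + inK (d / 2) *: v.
  have [Cy|nCy] := pselect (C y); last first.
    by exists y => //; exists 0 => //; rewrite scaler0 addr0.
  exists (y + inK (d / 2) *: b); last by exists b => //; exact: sub_seminorm_hull.
  move=> Cyb; apply: Cb.
  have -> : inK (d / 4) *: b =
      inK 2^-1 *: (y + inK (d / 2) *: b) + inK (- 2^-1) *: y.
    rewrite scalerDr scalerA -rmorphM rmorphN scaleNr addrAC subrr add0r.
    by congr (inK _ *: _); lra.
  move/abs_convexE : acC; apply => //.
  by rewrite !scalar_abs_of_real normrN gtr0_norm ?invr_gt0//; lra.
have : nbhs y' (~` C) by apply: open_nbhs_nbhs; split => //; exact: closed_openC.
move=> /nbhs_translate /(nbhs0_fundP hG)[q Gq [e e0 qC]].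
have /(bounded_fundP hG)/(_ q Gq)[M M0 qM] := seminorm_hull_bounded bB.
(* The first bound halves the radius; the second keeps perturbations by the hull within q-distance
   [e] of [y'], where [C] is missed. *)
exists y', (Num.min (d / 2) (e / (M + 1))); split => //.
- by rewrite lt_min !divr_gt0//; lra.
- by rewrite ge_min lexx.
move=> v Dv; apply: qC.
have m0 : 0 < Num.min (d / 2) (e / (M + 1)) by rewrite lt_min !divr_gt0//; lra.
rewrite (seminormZr (fund_seminorm hG Gq)) gtr0_norm//.
apply: (@le_trans _ _ (e / (M + 1) * (M + 1))); last first.
  by rewrite divfK// gt_eqF//; lra.
apply: ler_pM; [exact: ltW|exact: seminorm_ge0 (fund_seminorm hG Gq) _| |].
  by rewrite ge_min lexx orbT.
by have := qM _ Dv; lra.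
Qed.

(** If no [C n] absorbs [B], there are nested disks y_n + d_n D, with D the hull of [B], such that
    disk n + 1 misses [C n]. The centres are Mackey Cauchy with respect to D. As D is closed, their
    limit lies in every disk, hence in no [C n]. *)
Lemma mackey_cover B (C : nat -> set X) : mackey_complete X ->
  bounded_subset B -> (forall n, closed (C n)) ->
  (forall n, absolutely_convex (C n)) -> (forall x, exists n, C n x) ->
  exists n, exists2 r : R, 0 < r & forall b, B b -> C n (inK r *: b).
Proof.
move=> mX bB clC acC covC; apply: contrapT => nabs.
have nC n r : 0 < r -> exists2 b, B b & ~ C n (inK r *: b).
  move=> r0; apply: contrapT => h; apply: nabs; exists n, r => // b Bb.
  by apply: contrapT => nCb; apply: h; exists b.
have Bne : B !=set0 by have [b Bb _] := nC 0%N 1 ltr01; exists b.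
have acD := seminorm_hull_abs_convex Bne.
(* The guard [0 < s.2] lets the choice function be total; nonpositive radii get a dummy
   successor. *)
pose good n (s t : X * R) := 0 < s.2 -> [/\ 0 < t.2, t.2 <= s.2 / 2,
  exists2 v, seminorm_hull B v & t.1 = s.1 + inK (s.2 / 2) *: v &
  forall v, seminorm_hull B v -> ~ C n (t.1 + inK t.2 *: v)].
have /choice[f fP] : forall z : nat * (X * R), exists t, good z.1 z.2 t.
  move=> [n [y d]].
  have [d0|d0] := ltP 0 d; last first.
    by exists (y, d); rewrite /good/= => /lt_geF; rewrite d0.
  have [y' [d' yd']] := leave_closed_set bB (clC n) (acC n) (nC n) y d0.
  by exists (y', d').
pose s := fix s n := if n is m.+1 then f (m, s m) else (0 : X, 1 : R).
have d_gt0 n : 0 < (s n).2.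
  by elim: n => [|n IH] /=; [exact: ltr01|have [] := fP (n, s n) IH].
have sP n := fP (n, s n) (d_gt0 n).
have d_half n : (s n.+1).2 <= (s n).2 / 2 by have [] := sP n.
have d_ge n k : (s (n + k)%N).2 <= (s n).2.
  elim: k => [|k IH]; first by rewrite addn0.
  by rewrite addnS; have := d_half (n + k)%N; have := d_gt0 (n + k)%N; lra.
(* Later centres stay in disk n: the centre moves by half the radius and the next radius is at most
   the other half. *)
have tail k : forall n, exists2 v, seminorm_hull B v &
    (s (n + k)%N).1 = (s n).1 + inK (s n).2 *: v.
  elim: k => [|k IH] n.
    have [b0 Bb0] := Bne; exists 0; last by rewrite addn0 scaler0 addr0.
    by apply: abs_convex0 acD (sub_seminorm_hull Bb0).
  have [v Dv] := IH n.+1; rewrite addSnnS => ->.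
  have [_ d'd [w Dw /= ->] _] := sP n.
  set d := (s n).2; set d' := (f (n, s n)).2.
  have d0 : 0 < d := d_gt0 n.
  exists (inK (d' / d) *: v + inK 2^-1 *: w).
    move/abs_convexE : acD; apply => //.
    rewrite !scalar_abs_of_real !gtr0_norm ?invr_gt0// ?divr_gt0 ?(d_gt0 n.+1)//.
    have : d' / d <= 2^-1 by rewrite ler_pdivrMr// mulrC.
    lra.
  rewrite scalerDr !scalerA -!rmorphM mulrCA divff ?gt_eqF// mulr1.
  by rewrite -addrA [inK d' *: v + _]addrC.
have dbound n : (s n).2 <= 2^-1 ^+ n.
  elim: n => [|n IH]; first by rewrite expr0.
  by apply: le_trans (d_half n) _; rewrite exprSr ler_wpM2r.
have d_cvg0 : (s n).2 @[n --> \oo] --> (0 : R).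
  apply: (@squeeze_cvgr _ _ _ _ (fun=> 0) (fun n => 2^-1 ^+ n)).
  - by near=> n; rewrite dbound ltW.
  - exact: cvg_cst.
  - by apply: cvg_expr; rewrite ger0_norm//; lra.
have [l xl] : exists l : X, (fun n => (s n).1) @ \oo --> l.
  (* Two centres differ by an element of the hull scaled by the radius of the smaller index;
     symmetry of the hull covers both orders. *)
  apply: mX; exists (seminorm_hull B), (fun n k => inK (s (minn n k)).2); split.
  - exact: seminorm_hull_bounded.
  - apply/cvgr0Pnorm_lt => e /(@scalar_gt0 R F)[r r0 ->].
    have /cvgr0Pnorm_lt/(_ r r0)[N _ dN] := d_cvg0.
    exists ([set n | (N <= n)%N], [set n | (N <= n)%N]).
      by split; exists N.
    move=> [n k] /= [Nn Nk].
    rewrite -scalar_absE ltr_scalar scalar_abs_of_real.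
    by apply: dN => /=; rewrite leq_min Nn.
  - move=> n k /=; have [nk|kn] := leqP n k.
      have [v Dv] := tail (k - n)%N n; rewrite subnKC// => ->.
      exists (- v); last by rewrite scalerN opprD addrA subrr add0r.
      rewrite -scaleN1r; apply: abs_convexZ acD Dv _.
      by rewrite -(rmorph1 inK) -rmorphN scalar_abs_of_real normrN1.
    have [v Dv] := tail (n - k)%N k; rewrite subnKC ?(ltnW kn)// => ->.
    by exists v => //; rewrite addrAC subrr add0r.
have [n Cl] := covC l.
have [_ _ _ out] := sP n.
suff Dl : seminorm_hull B (inK (s n.+1).2^-1 *: (l - (s n.+1).1)).
  apply: (out _ Dl); rewrite /= scalerA -rmorphM divff ?gt_eqF ?(d_gt0 n.+1)//.
  by rewrite rmorph1 scale1r addrC subrK.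
apply: (@closed_cvg _ _ _ (@eventually_filter)
  (fun k => inK (s n.+1).2^-1 *: ((s k).1 - (s n.+1).1)) (seminorm_hull B)).
- exact: seminorm_hull_closed.
- exists n.+1 => // k /= nk; have [v Dv] := tail (k - n.+1)%N n.+1.
  rewrite subnKC// => ->; rewrite addrAC subrr add0r scalerA -rmorphM.
  by rewrite mulVf ?rmorph1 ?scale1r// gt_eqF ?(d_gt0 n.+1).
- apply: continuous_cvg; first exact: scale_contr.
  rewrite [l - _]addrC.
  under eq_fun do rewrite [(s _).1 - _]addrC.
  by apply: continuous_cvg => //; exact: add_contr.
Unshelve. all: by end_near. Qed.

End MackeyCover.

(** * Powers and suprema of real functions *)

Section RealAnalysis.
Context (R : realType).

Lemma powRN_cvg0 (s : R) : 0 < s -> t `^ (- s) @[t --> +oo] --> (0 : R).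
Proof.
move=> s0; apply/cvgr0Pnorm_le => e e0.
near=> t; rewrite ger0_norm ?powR_ge0// powRN.
have t0 : 0 < t by near: t; exact: nbhs_pinfty_gt.
rewrite -[leRHS]invrK lef_pV2 ?posrE ?invr_gt0 ?powR_gt0//.
rewrite -[leLHS]powRr1 ?invr_ge0 ?(ltW e0)// -(mulVf (lt0r_neq0 s0)) powRrM.
apply: ge0_ler_powR; rewrite ?nnegrE ?powR_ge0 ?(ltW s0) ?(ltW t0)//.
Unshelve. all: by end_near. Qed.

(** Convexity with weights u and 1 - u is applied to s and (v / (1 - u)) t, then again to t and 0;
    the point 0 carries the missing weight at no cost. *)
Lemma powR_subconvex (b u v s t : R) : 1 <= b -> 0 <= u -> 0 <= v ->
  u + v <= 1 -> 0 <= s -> 0 <= t ->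
  (u * s + v * t) `^ b <= u * s `^ b + v * t `^ b.
Proof.
move=> b1 u0 v0 uv1 s0 t0; have b0 : 0 < b := lt_le_trans ltr01 b1.
have cvx k x y : 0 <= k -> k <= 1 -> 0 <= x -> 0 <= y ->
    (k * x + (1 - k) * y) `^ b <= k * x `^ b + (1 - k) * y `^ b.
  move=> k0 k1 x0 y0.
  have := @convex_powR R b b1 (Itv01 k0 k1) x y.
  by rewrite !inE/= !in_itv/= !andbT => /(_ x0 y0).
have [v00|vn0] := eqVneq v 0.
  rewrite v00 !mul0r !addr0.
  have := cvx u s 0 u0 _ s0 (lexx _); rewrite powR0 ?gt_eqF// !mulr0 !addr0.
  by apply; lra.
have v_gt0 : 0 < v by rewrite lt_def vn0.
have u1 : 0 < 1 - u by lra.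
have := cvx u s (v / (1 - u) * t) u0 _ s0 _.
rewrite mulrA [_ * (v / _)]mulrCA divff ?gt_eqF// mulr1 => h.
have vu : 0 <= v / (1 - u) by rewrite divr_ge0// ltW.
have vu1 : v / (1 - u) <= 1 by rewrite ler_pdivrMr//; lra.
apply: (le_trans (h _ _)); [lra|exact: mulr_ge0|].
rewrite lerD2l.
have := cvx (v / (1 - u)) t 0 vu vu1 t0 (lexx _).
rewrite powR0 ?gt_eqF// !mulr0 !addr0 => h'.
apply: le_trans (ler_wpM2l (ltW u1) h') _.
by rewrite mulrA [_ * (v / _)]mulrCA divff ?gt_eqF// mulr1.
Qed.

(** [g] is an antiderivative that vanishes at infinity because a > 1; the shift by 1 removes the
    singularity at 0. *)
Lemma integral_powRN_lty (a : R) : 1 < a ->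
  (\int[lebesgue_measure]_(t in `[0%R, +oo[) ((1 + t) `^ (- a))%:E < +oo)%E.
Proof.
move=> a1; have a10 : a - 1 != 0 by rewrite subr_eq0 gt_eqF.
pose h (x : R) := x `^ (1 - a).
pose f t : R := (1 + t) `^ (- a).
pose g t : R := - ((a - 1)^-1 * (1 + t) `^ (1 - a)).
have dg (t : R) : 0 <= t -> is_derive t 1 g (f t).
  move=> t0; have t1 : 0 < 1 + t by rewrite ltr_pwDl.
  have d1 : is_derive (1 + t) 1 h ((1 - a) * (1 + t) `^ (1 - a - 1)).
    exact: is_derive1_powR.
  have d2 : is_derive t 1 (fun t : R => 1 + t) (0 + 1) by apply: is_deriveD.
  have := @is_derive1_comp R h (fun t : R => 1 + t) t _ _ d1 d2.
  move=> d3; apply: (is_derive_eq (is_deriveN (is_deriveZ (a - 1)^-1 d3))).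
  rewrite /f add0r mulr1 (_ : 1 - a - 1 = - a); last by ring.
  by rewrite /GRing.scale/=; field.
have cf (t : R) : 0 <= t -> {for t, continuous f}.
  move=> t0; have t1 : 0 < 1 + t by rewrite ltr_pwDl.
  suff : {for t, continuous
    ((fun x : R => x `^ (- a)) \o (fun t : R => 1 + t))} by [].
  apply: continuous_comp.
    by apply: continuousD; [exact: cst_continuous|exact: id].
  apply: differentiable_continuous; apply/derivable1_diffP.
  by apply: derivable_powR; rewrite in_itv/= andbT.
rewrite (@ge0_continuous_FTC2y _ f g 0 0).
- by rewrite sub0e -EFinN ltry.
- by move=> t _; exact: powR_ge0.
- by apply: continuous_in_subspaceT => t; rewrite inE/= in_itv/= andbT; exact: cf.
- rewrite -oppr0 -(mulr0 (a - 1)^-1); apply: cvgN; apply: cvgMr.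
  rewrite -opprB.
  apply: (@cvg_comp _ _ _ (fun t => 1 + t)
    (fun x : R => x `^ (- (a - 1))) _ (pinfty_nbhs R)).
    by apply/cvgryPge => A; near=> t; rewrite -lerBlDl.
  by apply: powRN_cvg0; rewrite subr_gt0.
- by move=> t t0; have [] := dg t (ltW t0).
- apply: cvg_at_right_filter; apply: differentiable_continuous.
  by apply/derivable1_diffP; have [] := dg 0 (lexx _).
- move=> t; rewrite in_itv/= andbT => t0; rewrite derive1E.
  by have [_ ->] := dg t (ltW t0).
Unshelve. all: by end_near. Qed.

End RealAnalysis.

Section SupOn.
Context (R : realType) (F : scalar_kind) (X : tvsType (scalars R F)).

(** The supremum may be infinite for some [t], but only eventual values count, and it is never
    negative since [sup_on] includes 0. *)
Lemma sup_on_cvg0P (B : set X) (f : R -> X -> R) :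
  sup_on B (f t) @[t --> +oo] --> 0%E <->
  (forall e, 0 < e -> \forall t \near +oo, forall x, B x -> f t x <= e).
Proof.
have sup_ge0 t : (0 <= sup_on B (f t))%E by apply: ereal_sup_ubound; left.
split=> [/fine_cvgP[ffin /cvgr0Pnorm_le h] e e0|h].
  have {}h := h e e0; near=> t => x Bx; rewrite -lee_fin.
  apply: (@le_trans _ _ (sup_on B (f t))).
    by apply: ereal_sup_ubound; right; exists x.
  have tf : sup_on B (f t) \is a fin_num by near: t.
  rewrite -(fineK tf) lee_fin; apply: le_trans (ler_norm _) _.
  by near: t.
have sup_le e : 0 < e -> \forall t \near +oo, (sup_on B (f t) <= e%:E)%E.
  move=> e0; have := h e e0; apply: filterS => t fe.
  apply: ge_ereal_sup => _ [->|[x Bx <-]]; rewrite lee_fin; first exact: ltW.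
  exact: fe.
apply/fine_cvgP; split.
  have := sup_le 1 ltr01; apply: filterS => t s1.
  by rewrite ge0_fin_numE// (le_lt_trans s1)// ltry.
apply/cvgr0Pnorm_le => e e0; have := sup_le e e0; apply: filterS => t se.
rewrite ger0_norm ?fine_ge0// -lee_fin fineK// ge0_fin_numE//.
by rewrite (le_lt_trans se)// ltry.
Unshelve. all: by end_near. Qed.

Lemma sup_on_powRN_cvg0 (B : set X) (f : R -> X -> R) (C s : R) :
  0 < s -> (forall t x, 0 < t -> B x -> f t x <= C * t `^ (- s)) ->
  sup_on B (f t) @[t --> +oo] --> 0%E.
Proof.
move=> s0 fC; apply/sup_on_cvg0P => e e0.
have Cs : C * t `^ (- s) @[t --> +oo] --> C * 0.
  by apply: cvgMr; exact: powRN_cvg0.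
move: Cs; rewrite mulr0 => /cvgr0Pnorm_le/(_ e e0) h.
near=> t => x Bx; apply: le_trans (fC t x _ Bx) _.
  by near: t; exact: nbhs_pinfty_gt.
by apply: le_trans (ler_norm _) _; near: t.
Unshelve. all: by end_near. Qed.

End SupOn.

(** * Decay of semigroup orbits *)

Section Semigroup.
Context (R : realType) (F : scalar_kind).
Local Notation K := (scalars R F).
Local Notation inK := (@scalar_of_real R F).
Context (X : tvsType K) (G : set (X -> R)) (T : R -> X -> X).
Hypothesis hG : fundamental_system G.
Hypothesis hT : C0_semigroup T.
Hypothesis hexp : exponentially_bounded T G.
Implicit Types (A B U : set X) (p q : X -> R).

(** Equicontinuity of the operators t^r T(t), t >= 0. Unlike a limit at infinity, such a bound
    composes with itself. *)
Definition decay_rate (r : R) : Prop := forall q, G q ->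
  exists2 p, G p & exists2 C : R, 0 <= C &
    forall t x, 0 <= t -> t `^ r * q (T t x) <= C * p x.

Lemma seminorm_weight q (c : R) : seminorm q -> 0 <= c ->
  seminorm (fun x => c * q x).
Proof.
move=> sq c0; split=> [x y|a x].
  by rewrite -mulrDr ler_wpM2l// seminormD.
by rewrite -scalar_absE -rmorphM/= seminormZ//; congr inK; rewrite mulrCA.
Qed.

Lemma seminorm_orbit q t : G q -> 0 <= t -> seminorm (fun x => q (T t x)).
Proof.
move=> Gq t0; have sq := fund_seminorm hG Gq; have lT := C0_linear hT t0.
split=> [x y|a x].
  by have := lT 1 x y; rewrite !scale1r => ->; exact: seminormD.
have T0 : T t 0 = 0 by have := lT (-1) 0 0; rewrite scaler0 addr0 scaleN1r addNr.
by have := lT a x 0; rewrite !addr0 T0 addr0 => ->; exact: sq.2.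
Qed.

Lemma continuous_orbit q t : G q -> 0 <= t -> continuous (fun x => q (T t x)).
Proof.
move=> Gq t0 x; apply: (@continuous_comp _ _ _ (T t) q).
  exact: (C0_continuous hT t0).
exact: (fund_continuous hG Gq).
Qed.

Lemma orbit_continuous q x : G q ->
  {within `[0, +oo[, continuous (fun t => q (T t x))}.
Proof.
move=> Gq t; apply: continuous_comp; first exact: (C0_strong hT).
exact: (fund_continuous hG Gq).
Qed.

Lemma weightedE q a t x : G q -> q (weighted T a t x) = t `^ a * q (T t x).
Proof.
move=> Gq; rewrite /weighted (seminormZr (fund_seminorm hG Gq)).
by rewrite ger0_norm// powR_ge0.
Qed.

(** [p] is fixed before [s], so only the constant depends on the time interval; [|w|] covers either
    sign of the growth exponent. *)
Lemma local_bound q : G q -> exists2 p, G p & forall s : R, 0 <= s ->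
  exists2 C : R, 0 < C & forall t x, 0 <= t <= s -> q (T t x) <= C * p x.
Proof.
move=> /hexp[p Gp [M [w [M1 qM]]]]; exists p => // s s0.
exists (M * expR (`|w| * s)); first by rewrite mulr_gt0 ?expR_gt0//; lra.
move=> t x /andP[t0 ts]; apply: le_trans (qM t x t0) _.
apply: ler_wpM2r; first exact: seminorm_ge0 (fund_seminorm hG Gp) _.
apply: ler_wpM2l; first lra.
rewrite ler_expR; apply: (@le_trans _ _ (`|w| * t)).
  by rewrite ler_wpM2r// ler_norm.
by rewrite ler_wpM2l.
Qed.

(** In T(t) = T(t/2) T(t/2) each factor contributes one of the two rates; the constant 2^(r + s)
    undoes the halving. *)
Lemma decay_rateD r s : 0 < r -> 0 < s ->
  decay_rate r -> decay_rate s -> decay_rate (r + s).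
Proof.
move=> r0 s0 dr ds q Gq.
have [q1 G1 [C1 C10 h1]] := dr q Gq; have [p Gp [C2 C20 h2]] := ds q1 G1.
exists p => //; exists (2 `^ (r + s) * (C1 * C2)).
  by rewrite !mulr_ge0// powR_ge0.
move=> t x t0; have t20 : 0 <= t / 2 by lra.
have -> : T t x = T (t / 2) (T (t / 2) x).
  by rewrite {1}(splitr t) (C0_add hT).
have -> : t `^ (r + s) = 2 `^ (r + s) * ((t / 2) `^ r * (t / 2) `^ s).
  rewrite -powRD; last by apply/implyP; rewrite gt_eqF// addr_gt0.
  by rewrite -powRM//; congr (_ `^ _); lra.
rewrite -!mulrA ler_wpM2l ?powR_ge0// mulrCA.
apply: (@le_trans _ _ ((t / 2) `^ s * (C1 * q1 (T (t / 2) x)))).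
  by rewrite ler_wpM2l ?powR_ge0// h1.
by rewrite mulrCA ler_wpM2l// h2.
Qed.

Lemma decay_rateMn r n : 0 < r -> decay_rate r -> decay_rate (r *+ n.+1).
Proof.
move=> r0 dr; elim: n => [|n IH]; first by rewrite mulr1n.
by rewrite mulrS; apply: decay_rateD => //; rewrite mulrn_wgt0.
Qed.

(** Some multiple of [r] exceeds [a], and the surplus power of t drives the supremum to zero. *)
Lemma decay_rate_seminorm_decay r : 0 < r -> decay_rate r ->
  forall a, seminorm_decay T G a.
Proof.
move=> r0 dr a.
pose n := Num.bound (`|a| / r).
have nr : a < r *+ n.+1.
  have : `|a| / r < n%:R by apply: archi_boundP; rewrite divr_ge0// ltW.
  rewrite ltr_pdivrMr// => h; apply: le_lt_trans (ler_norm a) _.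
  by apply: lt_trans h _; rewrite mulr_natl ltr_pMn2l.
move=> q Gq; have [p Gp [C C0 h]] := decay_rateMn n r0 dr Gq; exists p => //.
apply: (@sup_on_powRN_cvg0 _ _ _ _ _ C (r *+ n.+1 - a)).
  by rewrite subr_gt0.
move=> t x t0 /= px; rewrite weightedE//.
rewrite (_ : t `^ a = t `^ (- (r *+ n.+1 - a)) * t `^ (r *+ n.+1)); last first.
  rewrite -powRD; last by apply/implyP => _; rewrite gt_eqF.
  by congr (_ `^ _); ring.
rewrite -mulrA [leRHS]mulrC ler_wpM2l ?powR_ge0//.
apply: le_trans (h _ _ (ltW t0)) _; exact: ler_piMr.
Qed.

Lemma seminorm_decay_bounded_decay a :
  seminorm_decay T G a -> bounded_decay T G a.
Proof.
move=> dT B q /(bounded_fundP hG) bB Gq.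
have [p Gp hp] := dT q Gq; have [M M0 pM] := bB p Gp.
have M1 : 0 < M + 1 by lra.
apply/sup_on_cvg0P => e e0.
have /sup_on_cvg0P/(_ _ (divr_gt0 e0 M1)) h := hp.
have t_ge0 : \forall t \near +oo, (0 : R) <= t by exact: nbhs_pinfty_ge.
apply: filterS2 h t_ge0 => t ht t0 x Bx.
(* Dividing by [M + 1] brings [B] into the unit ball of [p]. *)
have : q (weighted T a t (inK (M + 1)^-1 *: x)) <= e / (M + 1).
  apply: ht => /=.
  rewrite (seminormZr (fund_seminorm hG Gp)) gtr0_norm ?invr_gt0//.
  by rewrite ler_pdivrMl// mulr1; have := pM x Bx; lra.
rewrite /= !weightedE// (seminormZr (seminorm_orbit Gq t0)) gtr0_norm ?invr_gt0//.
by rewrite mulrCA mulrC ler_pM2r ?invr_gt0.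
Qed.

(* Boundedness of the orbit on compact time intervals makes the bound valid for
   all t, and for every smaller exponent. *)
Lemma pointwise_decay_bounded a b q x : pointwise_decay T a x -> 0 <= b <= a ->
  G q -> exists C : R, forall t, 0 <= t -> t `^ b * q (T t x) <= C.
Proof.
move=> /(cvg_fund hG) /[swap] /andP[b0 ba] dx Gq.
have /cvgr0Pnorm_le/(_ 1 ltr01)[M [_ hM]] := dx q Gq.
(* Beyond this time the decay bound holds and t >= 1, so t^b <= t^a; the compact interval before it
   is left to [local_bound]. *)
have [p Gp /(_ (Num.max M 1))] := local_bound Gq.
have M0 : 0 <= Num.max M 1 by rewrite le_max ler01 orbT.
move=> /(_ M0)[C C0 qC].
have p0 := seminorm_ge0 (fund_seminorm hG Gp) x.
exists (Num.max M 1 `^ b * (C * p x) + 1) => t t0.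
have qt0 := seminorm_ge0 (fund_seminorm hG Gq) (T t x).
have [tM|Mt] := leP t (Num.max M 1).
  apply: (@le_trans _ _ (Num.max M 1 `^ b * (C * p x))); last lra.
  by apply: ler_pM; rewrite ?powR_ge0 ?qC ?t0// ge0_ler_powR ?nnegrE.
have [Mt1 Mt2] : M < t /\ 1 < t by move: Mt; rewrite gt_max => /andP[].
have {hM}/= := hM t Mt1; rewrite weightedE// => h.
apply: (@le_trans _ _ 1); last first.
  by rewrite lerDr mulr_ge0 ?powR_ge0// mulr_ge0// ltW.
apply: le_trans (le_trans (ler_norm _) h).
by rewrite ler_wpM2r// ler_powR// ltW.
Qed.

Definition orbit_ball (r c : R) q : set X :=
  [set x | forall t, 0 <= t -> t `^ r * q (T t x) <= c].

Lemma closed_orbit_ball r c q : G q -> closed (orbit_ball r c q).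
Proof.
move=> Gq.
have -> : orbit_ball r c q =
    \bigcap_(t in [set t | 0 <= t]) [set x | t `^ r * q (T t x) <= c].
  by apply/seteqP; split.
apply: closed_bigI => t t0.
have /continuous_closedP cf : continuous (fun x => t `^ r * q (T t x)).
  move=> x; apply: cvgMr; exact: continuous_orbit.
exact: cf (@closed_le R c).
Qed.

Lemma abs_convex_orbit_ball r c q : G q -> 0 <= c ->
  absolutely_convex (orbit_ball r c q).
Proof.
move=> Gq c0; apply/abs_convexE => x y a b xc yc ab t t0.
have sf := seminorm_weight (seminorm_orbit Gq t0) (powR_ge0 t r).
apply: le_trans (seminormD sf _ _) _; rewrite !(seminormZ sf).
apply: (@le_trans _ _ (scalar_abs a * c + scalar_abs b * c)).
  apply: lerD; apply: ler_wpM2l; rewrite ?scalar_abs_ge0//; [exact: xc|exact: yc].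
by rewrite -mulrDl ler_piMl.
Qed.

Lemma nbhs_orbit_ball r c q : G q -> 0 <= c ->
  nbhs (0 : X) (orbit_ball r c q) -> exists2 p, G p &
    exists2 C : R, 0 <= C & forall t x, 0 <= t -> t `^ r * q (T t x) <= C * p x.
Proof.
move=> Gq c0 /(nbhs0_fundP hG)[p Gp [d d0 pd]]; exists p => //.
exists (c / d); first by rewrite divr_ge0// ltW.
move=> t x t0.
have sf := seminorm_weight (seminorm_orbit Gq t0) (powR_ge0 t r).
apply: (homogeneous_dominated (f := fun x => t `^ r * q (T t x)) d0 c0
  (fund_seminorm hG Gp)).
  by move=> s y s0; rewrite (seminormZr sf) ger0_norm.
by move=> y /pd; apply.
Qed.

(** Every exponent exceeds 1, so rate 1 is bounded along each orbit and only the constant has to be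
    made uniform. *)
Lemma baire_decay_rate : baire_space X ->
  (forall x, exists2 a : R, 1 < a & pointwise_decay T a x) -> decay_rate 1.
Proof.
move=> bX dT q Gq.
have [n|n|x|n Cn] := @baire_cover _ _ _ (fun n => orbit_ball 1 n%:R q) bX.
- exact: closed_orbit_ball.
- exact: abs_convex_orbit_ball.
- have [a a1 dx] := dT x.
  have [|C hC] := @pointwise_decay_bounded a 1 q x dx _ Gq.
    by rewrite ler01 ltW.
  exists (Num.bound `|C|) => t t0; apply: le_trans (hC t t0) _.
  by apply: le_trans (ler_norm C) _; exact/ltW/archi_boundP.
- exact: nbhs_orbit_ball Cn.
Qed.

(** The exponents 1 + 1/(n + 1) come arbitrarily close to 1. If each fails, each yields a single
    seminorm [q n], so the cover is countable even when [G] is not. *)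
Lemma mackey_uniform_decay : mackey_complete X ->
  (forall x, exists2 a : R, 1 < a & pointwise_decay T a x) ->
  forall B, bounded_subset B -> exists2 a : R, 1 < a &
    forall q, G q -> uniform_decay_on T a B q.
Proof.
move=> mX dT B bB; pose a n : R := 1 + n.+1%:R^-1.
have a_gt1 n : 1 < a n by rewrite /a ltrDl invr_gt0.
suff [n hn] : exists n, forall q, G q -> exists C : R, forall t x, 0 <= t ->
    B x -> t `^ a n * q (T t x) <= C.
  (* Half of the excess over 1 is given up to turn boundedness into convergence to zero. *)
  exists (1 + (n.+1%:R^-1) / 2); first by rewrite ltrDl divr_gt0// invr_gt0.
  move=> q Gq; have [C hC] := hn q Gq.
  apply: (@sup_on_powRN_cvg0 _ _ _ _ _ C (n.+1%:R^-1 / 2)).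
    by rewrite divr_gt0// invr_gt0.
  move=> t x t0 Bx /=; rewrite weightedE//.
  rewrite (_ : t `^ _ = t `^ (- (n.+1%:R^-1 / 2)) * t `^ a n); last first.
    rewrite -powRD; last by apply/implyP => _; rewrite gt_eqF.
    congr (_ `^ _); rewrite /a; set u := _.+1%:R^-1; lra.
  by rewrite -mulrA [leRHS]mulrC ler_wpM2l ?powR_ge0// hC// ltW.
apply: contrapT => nhn.
have /choice[q qP] : forall n, exists q, G q /\ ~ exists C : R,
    forall t x, 0 <= t -> B x -> t `^ a n * q (T t x) <= C.
  move=> n; apply: contrapT => h; apply: nhn; exists n => q Gq.
  by apply: contrapT => hC; apply: h; exists q.
have Gq n : G (q n) by have [] := qP n.
(* Enumerates the pairs of exponent index and constant; the default only repeats the set of the pair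
   (0, 0). *)
pose nk j : nat * nat := odflt (0, 0)%N (unpickle j).
have [j|j|x|j [r r0 rB]] := @mackey_cover _ _ _ _ hG B
  (fun j => orbit_ball (a (nk j).1) (nk j).2%:R (q (nk j).1)) mX bB.
- exact: closed_orbit_ball.
- exact: abs_convex_orbit_ball.
- have [b b1 dx] := dT x.
  pose n := Num.bound (b - 1)^-1.
  have anb : a n <= b.
    rewrite /a -lerBrDl -[leRHS]invrK lef_pV2 ?posrE ?invr_gt0 ?subr_gt0//.
    have : (b - 1)^-1 < n%:R by apply: archi_boundP; rewrite invr_ge0; lra.
    by move=> /ltW h; apply: le_trans h _; rewrite ler_nat.
  have [|C hC] := @pointwise_decay_bounded b (a n) (q n) x dx _ (Gq n).
    by rewrite anb andbT; have := a_gt1 n; lra.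
  exists (pickle (n, Num.bound `|C|)); rewrite /nk pickleK/= => t t0.
  apply: le_trans (hC t t0) _.
  by apply: le_trans (ler_norm C) _; exact/ltW/archi_boundP.
- move: rB; set n := (nk j).1; set k := (nk j).2 => rB.
  have [_] := qP n; apply; exists (r^-1 * k%:R) => t x t0 Bx.
  have := rB x Bx t t0.
  rewrite (seminormZr (seminorm_orbit (Gq n) t0)) gtr0_norm//.
  by rewrite mulrCA ler_pdivlMl.
Qed.

End Semigroup.

(** * Integrable orbits *)

Section Datko.
Context (R : realType) (F : scalar_kind).
Local Notation K := (scalars R F).
Local Notation inK := (@scalar_of_real R F).
Context (X : tvsType K) (G : set (X -> R)) (T : R -> X -> X).
Hypothesis hG : fundamental_system G.
Hypothesis hT : C0_semigroup T.
Hypothesis hexp : exponentially_bounded T G.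
Implicit Types (A B U : set X) (p q : X -> R).

(** The absolute value gives continuity on the whole line; away from 0 it comes from derivability of
    the power at positive bases. *)
Lemma continuous_powR_norm (b : R) : 0 < b -> continuous (fun x : R => `|x| `^ b).
Proof.
move=> b0 x; have [->|x0] := eqVneq x 0; last first.
  suff : {for x, continuous ((fun y : R => y `^ b) \o (@Num.norm R R))} by [].
  apply: continuous_comp; first exact: norm_continuous.
  apply: differentiable_continuous; apply/derivable1_diffP.
  by apply: derivable_powR; rewrite in_itv/= andbT normr_gt0.
rewrite /continuous_at normr0 powR0 ?gt_eqF//.
apply/cvgr0Pnorm_le => e e0; near=> y.
rewrite ger0_norm ?powR_ge0// -[leRHS]powRr1 ?(ltW e0)//.
rewrite -(mulVf (lt0r_neq0 b0)) powRrM.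
apply: ge0_ler_powR; rewrite ?nnegrE ?powR_ge0 ?(ltW b0)//.
near: y; have eb : 0 < e `^ b^-1 by rewrite powR_gt0.
have /cvgr0Pnorm_le := @cvg_id _ (nbhs (0 : R)); exact.
Unshelve. all: by end_near. Qed.

Lemma measurable_orbit (b : R) q x : G q ->
  measurable_fun (`[0, +oo[%classic : set R) (fun t => q (T t x) `^ b).
Proof.
move=> Gq; apply: (@measurableT_comp _ _ _ _ _ _ (fun y : R => y `^ b)).
  exact: measurable_powR.
apply: subspace_continuous_measurable_fun; first exact: measurable_itv.
exact: (orbit_continuous hG hT).
Qed.

(** Bounds of orders a and 0 combine into C (1 + t)^(-a), whose b-th power is integrable since a b >
    1. *)
Lemma pointwise_decay_integrable a : 1 < a ->
  (forall x, pointwise_decay T a x) ->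
  forall b, 1 <= b -> integrable_orbits T G b.
Proof.
move=> a1 da b b1 q x Gq.
have a0 : 0 <= a by lra.
have [|C1 hC1] := pointwise_decay_bounded hG hexp (b := a) (da x) _ Gq.
  by rewrite a0 lexx.
have [|C0 hC0] := pointwise_decay_bounded hG hexp (b := 0) (da x) _ Gq.
  by rewrite lexx a0.
(* 1 + t is at most 2 for t <= 1 and at most 2t afterwards, whence the factor 2^a. *)
pose C := 2 `^ a * (`|C1| + `|C0|).
have C_ge0 : 0 <= C by rewrite mulr_ge0 ?powR_ge0// addr_ge0.
have qC t : 0 <= t -> q (T t x) <= C * (1 + t) `^ (- a).
  move=> t0; have t1 : 0 < 1 + t by lra.
  have q0 := seminorm_ge0 (fund_seminorm hG Gq) (T t x).
  rewrite powRN ler_pdivlMr ?powR_gt0// mulrC /C.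
  have [t1'|t1'] := leP t 1.
    apply: ler_pM; rewrite ?powR_ge0//.
      by apply: ge0_ler_powR; rewrite ?nnegrE//; lra.
    have := hC0 t t0; rewrite powRr0 mul1r => /le_trans; apply.
    by rewrite (le_trans (ler_norm _))// lerDr.
  apply: (@le_trans _ _ ((2 * t) `^ a * q (T t x))).
    by rewrite ler_wpM2r//; apply: ge0_ler_powR; rewrite ?nnegrE//; lra.
  rewrite powRM// -mulrA ler_wpM2l ?powR_ge0//.
  by rewrite (le_trans (hC1 t t0))// (le_trans (ler_norm _))// lerDl.
have ab : 1 < a * b by nra.
have b0 : 0 <= b by lra.
have mpow : measurable_fun (`[0, +oo[%classic : set R)
    (fun t : R => ((1 + t) `^ (- (a * b)))%:E).
  apply/measurable_EFinP.
  apply: (@measurableT_comp _ _ _ _ _ _ (fun y : R => y `^ (- (a * b)))).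
    exact: measurable_powR.
  by apply: measurable_funD; [exact: measurable_cst|exact: measurable_id].
apply: (@le_lt_trans _ _ (\int[lebesgue_measure]_(t in `[0%R, +oo[)
    ((C `^ b)%:E * ((1 + t) `^ (- (a * b)))%:E))%E).
  apply: ge0_le_integral => //.
  - by move=> t _; rewrite lee_fin powR_ge0.
  - by apply/measurable_EFinP; exact: measurable_orbit.
  - exact: measurable_funeM.
  - move=> t; rewrite /= in_itv/= andbT => t0; rewrite -EFinM lee_fin.
    rewrite -mulNr powRrM -powRM ?powR_ge0//.
    apply: ge0_ler_powR; rewrite ?nnegrE ?mulr_ge0 ?powR_ge0//; last exact: qC.
    exact: seminorm_ge0 (fund_seminorm hG Gq) _.
rewrite ge0_integralZl//.
- by apply: lte_mul_pinfty; rewrite ?lee_fin ?powR_ge0//; exact: integral_powRN_lty.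
- by move=> t _; rewrite lee_fin powR_ge0.
- by rewrite lee_fin powR_ge0.
Qed.

(* The value of the orbit at n + 1 is dominated by its values on [n, n + 1],
   so the integral controls the sum of the orbit over the integers. *)
Lemma integrable_orbits_sum b q x : 1 <= b -> integrable_orbits T G b -> G q ->
  exists C : R, forall N, \sum_(i < N) q (T i%:R x) `^ b <= C.
Proof.
move=> b1 intb Gq; have b0 : 0 <= b by lra.
have [p Gp /(_ 1 ler01)[C C0 qp]] := local_bound hG hexp Gq.
pose g t := C `^ b * p (T t x) `^ b.
have g0 t : 0 <= g t by rewrite mulr_ge0 ?powR_ge0.
have mg : measurable_fun (`[0, +oo[%classic : set R) (EFin \o g).
  apply/measurable_EFinP; apply: measurable_funM; first exact: measurable_cst.
  exact: measurable_orbit.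
have mgI (a c : itv_bound R) : (BLeft 0 <= a)%O ->
    measurable_fun [set` Interval a c] (EFin \o g).
  move=> a0; apply: measurable_funS mg => //.
  by apply: subset_itv => //; case: c => [[] ?|[]].
have int_g : (\int[lebesgue_measure]_(t in `[0%R, +oo[) (g t)%:E < +oo)%E.
  under eq_integral do rewrite /g EFinM.
  rewrite ge0_integralZl//.
  - by apply: lte_mul_pinfty; rewrite ?lee_fin ?powR_ge0//; exact: intb.
  - by apply/measurable_EFinP; exact: measurable_orbit.
  - by move=> t _; rewrite lee_fin powR_ge0.
  - by rewrite lee_fin powR_ge0.
have q_le_g n t : n%:R <= t -> t <= n.+1%:R -> q (T n.+1%:R x) `^ b <= g t.
  move=> nt tn; rewrite /g -powRM//; last 2 first.
  - exact: ltW.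
  - exact: seminorm_ge0 (fund_seminorm hG Gp) _.
  have t0 : 0 <= t by apply: le_trans nt.
  apply: ge0_ler_powR; rewrite ?nnegrE//.
  - exact: seminorm_ge0 (fund_seminorm hG Gq) _.
  - by rewrite mulr_ge0 ?(ltW C0)//; exact: seminorm_ge0 (fund_seminorm hG Gp) _.
  (* The remaining time n + 1 - t lies in [0, 1], where the local bound applies. *)
  have nt0 : 0 <= n.+1%:R - t by rewrite subr_ge0.
  have := C0_add hT nt0 t0; rewrite subrK => ->.
  apply: qp; rewrite subr_ge0 tn/= lerBlDr -natr1.
  by rewrite addrC lerD2l.
have sum_le N : ((\sum_(i < N) q (T i.+1%:R x) `^ b)%:E <=
    \int[lebesgue_measure]_(t in `[0%R, N%:R[) (g t)%:E)%E.
  elim: N => [|N IH].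
    by rewrite big_ord0; apply: integral_ge0 => t _; rewrite lee_fin.
  rewrite big_ord_recr/= EFinD.
  rewrite (@itv_bndbnd_setU _ _ (BLeft 0) (BLeft N%:R)) ?bnd_simp ?ler_nat//.
  rewrite ge0_integral_setU//=; last 3 first.
  - rewrite -itv_bndbnd_setU ?bnd_simp ?ler_nat//; exact: mgI.
  - by move=> t _; rewrite lee_fin.
  - apply/disj_setPLR => t/=; rewrite !in_itv/= => /andP[_ tN] /andP[Nt _].
    by move: tN; rewrite ltNge Nt.
  apply: leeD => //.
  rewrite -[leLHS]mule1.
  have -> : 1%E = lebesgue_measure (`[N%:R, N.+1%:R[%classic : set R).
    by rewrite lebesgue_measure_itv/= lte_fin ltr_nat ltnSn -EFinB -natr1 addrAC
      subrr add0r.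
  rewrite -integral_cst//; apply: ge0_le_integral => //.
  - by move=> t _; rewrite lee_fin powR_ge0.
  - by apply: mgI; rewrite bnd_simp.
  - move=> t; rewrite /= in_itv/= => /andP[Nt tN]; rewrite lee_fin.
    exact: q_le_g (ltW tN).
pose I := (\int[lebesgue_measure]_(t in `[0%R, +oo[) (g t)%:E)%E.
have I0 : (0 <= I)%E by apply: integral_ge0 => t _; rewrite lee_fin.
(* The term at time 0 has no preceding unit interval and is added by hand. *)
exists (q (T 0 x) `^ b + fine I) => -[|N].
  by rewrite big_ord0 addr_ge0 ?powR_ge0// fine_ge0.
rewrite big_ord_recl lerD2l -lee_fin fineK ?ge0_fin_numE//.
apply: le_trans (sum_le N) _; apply: ge0_subset_integral => //.
  by move=> t _; rewrite lee_fin.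
by apply: subset_itvl.
Qed.

End Datko.

(** * From integrability to a decay rate in barrelled spaces *)

Section DatkoBarrel.
Context (R : realType) (F : scalar_kind).
Local Notation K := (scalars R F).
Local Notation inK := (@scalar_of_real R F).
Context (X : tvsType K) (G : set (X -> R)) (T : R -> X -> X).
Hypothesis hG : fundamental_system G.
Hypothesis hT : C0_semigroup T.
Hypothesis hexp : exponentially_bounded T G.
Hypothesis hX : barrelled X.
Variable b : R.
Hypothesis b1 : 1 <= b.
Hypothesis intb : integrable_orbits T G b.
Implicit Types (A B U : set X) (p q : X -> R).

Let b_gt0 : 0 < b.
Proof. exact: lt_le_trans ltr01 b1. Qed.

(** Bounding all partial sums stands for bounding the series, and lets closedness be checked one
    finite sum at a time. *)
Definition orbit_barrel q : set X :=
  [set x | forall N, \sum_(i < N) q (T i%:R x) `^ b <= 1].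

Lemma abs_convex_orbit_barrel q : G q -> absolutely_convex (orbit_barrel q).
Proof.
move=> Gq; apply/abs_convexE => x y u v xq yq uv N.
have u0 := scalar_abs_ge0 u; have v0 := scalar_abs_ge0 v.
apply: (@le_trans _ _ (scalar_abs u * \sum_(i < N) q (T i%:R x) `^ b +
    scalar_abs v * \sum_(i < N) q (T i%:R y) `^ b)); last first.
  apply: (@le_trans _ _ (scalar_abs u * 1 + scalar_abs v * 1)); last lra.
  by apply: lerD; apply: ler_wpM2l.
rewrite !mulr_sumr -big_split/=; apply: ler_sum => i _.
have so := seminorm_orbit hG hT Gq (ler0n R i).
apply: le_trans (powR_subconvex b1 u0 v0 uv (seminorm_ge0 so x) (seminorm_ge0 so y)).
apply: ge0_ler_powR; rewrite ?nnegrE ?(ltW b_gt0) ?(seminorm_ge0 so)//.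
  by rewrite addr_ge0// mulr_ge0// (seminorm_ge0 so).
by apply: le_trans (seminormD so _ _) _; rewrite !(seminormZ so).
Qed.

Lemma absorbing_orbit_barrel q : G q -> absorbing (orbit_barrel q).
Proof.
move=> Gq; apply: absorbingP; first exact: abs_convex_orbit_barrel.
move=> x; have [C hC] := integrable_orbits_sum hG hT hexp x b1 intb Gq.
have C1 : 0 < 1 + `|C| by have := normr_ge0 C; lra.
(* This scale is at most 1, so its b-th power is at most itself. *)
exists (1 + `|C|)^-1; first by rewrite invr_gt0.
move=> N.
apply: (@le_trans _ _ ((1 + `|C|)^-1 * \sum_(i < N) q (T i%:R x) `^ b)).
  rewrite mulr_sumr; apply: ler_sum => i _.
  have so := seminorm_orbit hG hT Gq (ler0n R i).
  rewrite (seminormZr so) gtr0_norm ?invr_gt0//.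
  apply: ge1r_powRZ => //; last exact: (seminorm_ge0 so).
  by rewrite invr_gt0 C1/= invf_le1//; have := normr_ge0 C; lra.
rewrite ler_pdivrMl// mulr1; apply: le_trans (hC N) _.
by have := ler_norm C; lra.
Qed.

Lemma closed_orbit_barrel q : G q -> closed (orbit_barrel q).
Proof.
move=> Gq.
have -> : orbit_barrel q = \bigcap_(N in [set: nat])
    [set x | \sum_(i < N) `|q (T i%:R x)| `^ b <= 1].
  have normq x N :
      \sum_(i < N) `|q (T i%:R x)| `^ b = \sum_(i < N) q (T i%:R x) `^ b.
    apply: eq_bigr => i _; rewrite ger0_norm//.
    exact: (seminorm_ge0 (seminorm_orbit hG hT Gq (ler0n R i))).
  apply/seteqP; split=> x qx N; first by move=> _ /=; rewrite normq.
  by rewrite -normq; exact: qx.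
apply: closed_bigI => N _.
have /continuous_closedP cf :
    continuous (fun x => \sum_(i < N) `|q (T i%:R x)| `^ b).
  apply: continuous_big => [|i _ x]; first exact: add_continuous.
  apply: (@continuous_comp _ _ _ (fun x => q (T i%:R x)) (fun y : R => `|y| `^ b)).
    exact: (continuous_orbit hG hT Gq (ler0n R i)).
  exact: continuous_powR_norm.
exact: cf (@closed_le R 1).
Qed.

Lemma orbit_barrel_ball q : G q -> exists2 p, G p &
  exists2 d : R, 0 < d & forall x, p x <= d -> orbit_barrel q x.
Proof.
move=> Gq; apply: (nbhs0_fundP hG); apply: hX.
- exact: abs_convex_orbit_barrel.
- exact: absorbing_orbit_barrel.
- exact: closed_orbit_barrel.
Qed.

(** On a ball inside the barrel each term of the sum is at most 1, so each q(T(n)x) is too. *)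
Lemma orbit_equicontinuous q : G q -> exists2 p, G p &
  exists2 C : R, 0 < C & forall n x, q (T n%:R x) <= C * p x.
Proof.
move=> Gq; have [p Gp [d d0 pd]] := orbit_barrel_ball Gq.
exists p => //; exists (1 / d); first by rewrite divr_gt0.
move=> n; have so := seminorm_orbit hG hT Gq (ler0n R n).
apply: (homogeneous_dominated (f := fun x => q (T n%:R x)) d0 ler01
  (fund_seminorm hG Gp)).
  by move=> s y s0; rewrite (seminormZr so) ger0_norm.
move=> y /pd/(_ n.+1); rewrite big_ord_recr/= => qy.
have q0 := seminorm_ge0 so y.
rewrite leNgt; apply/negP => q1; move: qy; rewrite leNgt => /negP; apply.
rewrite ltr_wpDl//; first by apply: sumr_ge0 => i _; exact: powR_ge0.
have := @gt0_ltr_powR _ b b_gt0 1 (q (T n%:R y)).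
by rewrite powR1 !nnegrE; apply.
Qed.

(** From T(n) = T(n - i) T(i), equicontinuity bounds q(T(n)y) by C q1(T(i)y) for every i <= n.
    Adding the b-th powers of these n + 1 bounds on the barrel of [q1] gives (n + 1) q(T(n)y)^b <=
    C^b. *)
Lemma orbit_rate_nat q : G q -> exists2 p, G p & exists2 C : R, 0 <= C &
  forall n x, n.+1%:R `^ b^-1 * q (T n%:R x) <= C * p x.
Proof.
move=> Gq; have [q1 G1 [C C0 qC]] := orbit_equicontinuous Gq.
have [p Gp [d d0 pd]] := orbit_barrel_ball G1.
exists p => //; exists (C / d); first by rewrite divr_ge0// ltW.
move=> n.
have so := seminorm_orbit hG hT Gq (ler0n R n).
have sf := seminorm_weight so (powR_ge0 n.+1%:R b^-1).
apply: (homogeneous_dominated (f := fun x => n.+1%:R `^ b^-1 * q (T n%:R x))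
  d0 (ltW C0) (fund_seminorm hG Gp)).
  by move=> s y s0; rewrite (seminormZr sf) ger0_norm.
move=> y /pd/(_ n.+1) sum1.
have q0 := seminorm_ge0 so y.
have : n.+1%:R * q (T n%:R y) `^ b <= C `^ b.
  apply: (@le_trans _ _ (C `^ b * \sum_(i < n.+1) q1 (T i%:R y) `^ b)); last first.
    by rewrite ler_piMr// powR_ge0.
  rewrite mulr_sumr mulr_natl -[X in _ *+ X]card_ord -sumr_const.
  apply: ler_sum => i _.
  have si := seminorm_orbit hG hT G1 (ler0n R i).
  rewrite -powRM ?(ltW C0)//; last exact: (seminorm_ge0 si).
  apply: ge0_ler_powR; rewrite ?nnegrE ?(ltW b_gt0)//.
    by rewrite mulr_ge0 ?(ltW C0)// (seminorm_ge0 si).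
  have ni : (i <= n)%N by rewrite -ltnS.
  have := C0_add hT (ler0n R (n - i)%N) (ler0n R i).
  by rewrite -natrD subnK// => ->; exact: qC.
move=> h.
have binv x : 0 <= x -> (x `^ b) `^ b^-1 = x.
  by move=> x0; rewrite -powRrM divff ?powRr1// gt_eqF.
rewrite -[leRHS]binv ?(ltW C0)// -[q _]binv// -powRM ?powR_ge0//.
apply: ge0_ler_powR; rewrite ?nnegrE ?invr_ge0 ?(ltW b_gt0) ?powR_ge0//.
by rewrite mulr_ge0 ?powR_ge0.
Qed.

(** With n the integer part of t, T(t) = T(t - n) T(n): the first factor is bounded on [0, 1], and t
    < n + 1 transfers the rate. *)
Lemma barrelled_decay_rate : decay_rate G T b^-1.
Proof.
move=> q Gq; have [q1 G1 /(_ 1 ler01)[C1 C10 h1]] := local_bound hG hexp Gq.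
have [p Gp [C C0 h]] := orbit_rate_nat G1.
exists p => //; exists (C1 * C); first by rewrite mulr_ge0// ltW.
move=> t x t0; have /andP[nt tn] := truncn_itv t0.
set n := Num.truncn t in nt tn.
have tn0 : 0 <= t - n%:R by rewrite subr_ge0.
have := C0_add hT tn0 (ler0n R n); rewrite subrK => ->.
have qT : q (T (t - n%:R) (T n%:R x)) <= C1 * q1 (T n%:R x).
  by apply: h1; rewrite tn0 lerBlDr addrC natr1 ltW.
apply: (@le_trans _ _ (n.+1%:R `^ b^-1 * (C1 * q1 (T n%:R x)))).
  apply: ler_pM; rewrite ?powR_ge0//.
    exact: seminorm_ge0 (fund_seminorm hG Gq) _.
  by apply: ge0_ler_powR; rewrite ?nnegrE ?invr_ge0 ?(ltW b_gt0)// ltW.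
by rewrite mulrCA -mulrA ler_wpM2l ?(ltW C10).
Qed.

End DatkoBarrel.

(** * Assembling the implications *)

Theorem theorem2p5 (R : realType) (F : scalar_kind) (X : tvsType (scalars R F))
    (hX : hausdorff_space X)
    (G : set (X -> R)) (hG : fundamental_system G)
    (T : R -> X -> X) (hT : C0_semigroup T) (hexp : exponentially_bounded T G) :
  let i := super_polynomially_stable T G in
  let ii := exists2 alpha : R, 1 < alpha & bounded_decay T G alpha in
  let iii_all := forall alpha : R, 1 < alpha -> seminorm_decay T G alpha in
  let iii_ex := exists2 alpha : R, 1 < alpha & seminorm_decay T G alpha in
  let iv_all := forall alpha : R, 1 < alpha ->
    forall x, pointwise_decay T alpha x in
  let iv_ex := exists2 alpha : R, 1 < alpha &
    forall x, pointwise_decay T alpha x in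
  let v_all := forall beta : R, 1 <= beta -> integrable_orbits T G beta in
  let v_ex := exists2 beta : R, 1 <= beta & integrable_orbits T G beta in
  let vi := forall x, exists2 alpha : R, 1 < alpha & pointwise_decay T alpha x in
  let vii := forall B, bounded_subset B -> exists2 alpha : R, 1 < alpha &
    forall q, G q -> uniform_decay_on T alpha B q in
  [/\ barrelled X ->
        [<-> i; ii; iii_all; iii_ex; iv_all; iv_ex; v_all; v_ex],
      mackey_complete X -> (vi <-> vii) &
      baire_space X ->
        [<-> i; ii; iii_all; iii_ex; iv_all; iv_ex; v_all; v_ex; vi; vii]].

Proof.
move=> i ii iii_all iii_ex iv_all iv_ex v_all v_ex vi vii.
have rate_all r : 0 < r -> decay_rate G T r -> iii_all.
  by move=> r0 dr a _; exact: (decay_rate_seminorm_decay hG hT r0 dr).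
have iii_i : iii_all -> i.
  move=> h a a1; exact: (seminorm_decay_bounded_decay hG hT (h a a1)).
have bounded1 (x : X) : bounded_subset [set x].
  by apply/(bounded_fundP hG) => q Gq; exists (q x) => [|_ ->];
    [exact: seminorm_ge0 (fund_seminorm hG Gq) _|].
have at_point a x : (forall q, G q -> uniform_decay_on T a [set x] q) ->
    pointwise_decay T a x.
  move=> h; apply/(cvg_fund hG) => q Gq; apply/cvgr0Pnorm_le => e e0.
  have /sup_on_cvg0P/(_ e e0) := h q Gq; apply: filterS => t /(_ x erefl).
  by rewrite ger0_norm// (seminorm_ge0 (fund_seminorm hG Gq)).
have bounded_iv a : bounded_decay T G a -> forall x, pointwise_decay T a x.
  by move=> h x; apply: at_point => q; exact: h.
have i_ii : i -> ii.
  by move=> h; exists 2; [|apply: h]; lra.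
have ii_iv : ii -> iv_ex by move=> [a a1 /bounded_iv]; exists a.
have iii_ex_all : iii_all -> iii_ex.
  by move=> h; exists 2; [|apply: h]; lra.
have iii_iv : iii_ex -> iv_ex.
  move=> [a a1 h]; apply: ii_iv; exists a => //.
  exact: (seminorm_decay_bounded_decay hG hT h).
have i_iv : i -> iv_all by move=> h a a1; exact/bounded_iv/h.
have iv_all_ex : iv_all -> iv_ex.
  by move=> h; exists 2; [|apply: h]; lra.
have iv_v : iv_ex -> v_all.
  by move=> [a a1 h]; exact: (pointwise_decay_integrable hG hT hexp a1 h).
have v_all_ex : v_all -> v_ex by move=> h; exists 1; [|exact: h].
(* The one implication here that uses barrelledness; it closes the cycle from [iv_ex] through
   [v_all] and [v_ex]. *)
have v_iii : barrelled X -> v_ex -> iii_all.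
  move=> bX [b b1 intb]; apply: (@rate_all b^-1); first by rewrite invr_gt0; lra.
  exact: (barrelled_decay_rate hG hT hexp bX b1 intb).
have vii_vi : vii -> vi.
  by move=> h x; have [a a1 /at_point] := h _ (bounded1 x); exists a.
have iv_vi : iv_ex -> vi by move=> [a a1 h] x; exists a.
have i_vii : i -> vii.
  by move=> h B bB; exists 2 => [|q Gq]; [lra|apply: h => //; lra].
split=> [bX|mX|bX].
- have {}v_iii := v_iii bX; tfae; tauto.
- split=> //; exact: (mackey_uniform_decay hG hT hexp mX).
- have {}v_iii := v_iii (baire_barrelled bX).
  (* In a Baire space rate 1 follows from (vi) directly, without integrals. *)
  have vi_iii : vi -> iii_all.
    move=> h; apply: (rate_all 1 ltr01).
    exact: (baire_decay_rate hG hT hexp bX h).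
  tfae; tauto.
Qed.
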